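(* The embedding $\iota_e:\mathrm{NC}(n)\rightarrow \mathrm C^*( *_1^n\mathbb Z_2)$ is pure in the cone $\mathcal{CP}(\mathrm{NC}(n),\mathrm C^*( *_1^n\mathbb Z_2))$ for every $n\geq 3$.
   Context: $*_1^n\mathbb Z_2$ is the free product of $n$ copies of $\mathbb Z_2$, with canonical generators $v_1,\dots,v_n$ (one for each copy); $\mathrm C^*( *_1^n\mathbb Z_2)$ is its full group C$^*$-algebra, in which each $v_j$ is a selfadjoint unitary. $\mathrm{NC}(n)=\mathrm{Span}\{1,v_1,\dots,v_n\}\subset\mathrm C^*( *_1^n\mathbb Z_2)$, an operator system (unital selfadjoint subspace). $\iota_e$ is the inclusion map (and $(\mathrm C^*( *_1^n\mathbb Z_2),\iota_e)$ is the C$^*$-envelope of $\mathrm{NC}(n)$). For operator systems $\mathcal R,\mathcal T$, $\mathcal{CP}(\mathcal R,\mathcal T)$ is the convex cone of completely positive linear maps $\mathcal R\to\mathcal T$; $\phi$ is pure in this cone if, whenever $\vartheta,\omega\in\mathcal{CP}(\mathcal R,\mathcal T)$ satisfy $\vartheta+\omega=\phi$, there is $s\in[0,1]$ with $\vartheta=s\phi$ and $\omega=(1-s)\phi$. *)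

(* Defs.v *)
From HB Require Import structures.
From mathcomp Require Import all_boot all_order all_algebra finmap.
From mathcomp Require Import all_classical all_reals.
From mathcomp Require Import complex.

Set Implicit Arguments.
Unset Strict Implicit.
Unset Printing Implicit Defensive.

Import Order.TTheory GRing.Theory Num.Theory.

Local Open Scope classical_set_scope.
Local Open Scope ring_scope.

(* The free product of n copies of Z/2, in normal form: words in the letters  *)
(* v_0, ..., v_(n-1) without two equal consecutive letters (as v_j * v_j = 1  *)
(* there are no exponents), multiplied by concatenation and cancellation.     *)
(* [freeZ2_universal] and [freeZ2_unique] are the coproduct property.         *)

Section FreeZ2.
Variable n : nat.
Implicit Types (i j : 'I_n) (w : seq 'I_n).

Definition reduced w := sorted (fun i j => i != j) w.

Record freeZ2 := FreeZ2 { fword :> seq 'I_n; _ : reduced fword }.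
HB.instance Definition _ := [isSub for fword].
HB.instance Definition _ := [Choice of freeZ2 by <:].

Definition push i w :=
  if w is j :: w' then (if i == j then w' else i :: w) else [:: i].

Lemma reduced_behead i w : reduced (i :: w) -> reduced w.
Proof. exact: path_sorted. Qed.

Lemma push_reduced i w : reduced w -> reduced (push i w).
Proof.
case: w => [//|j w] rw /=; case: ifPn => [_|neq]; first exact: reduced_behead rw.
by rewrite /reduced /= neq.
Qed.

Lemma pushK i w : reduced w -> push i (push i w) = w.
Proof.
case: w => [|j w] /=; first by rewrite eqxx.
case: eqP => [<-|_] rw /=; last by rewrite eqxx.
by case: w rw => [//|k w] /= /andP[/negPf->].
Qed.

Lemma push_cons i w : reduced (i :: w) -> push i w = i :: w.
Proof. by case: w => [//|j w] /= /andP[/negPf->]. Qed.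

Definition wmul w1 w2 := foldr push w2 w1.

Lemma wmul_reduced w1 w2 : reduced w2 -> reduced (wmul w1 w2).
Proof. by move=> r2; elim: w1 => //= i w1; apply: push_reduced. Qed.

Lemma wmul_push i w1 w2 : reduced w1 -> reduced w2 ->
  wmul (push i w1) w2 = push i (wmul w1 w2).
Proof.
case: w1 => [//|j w1] /= r1 r2; case: eqP => [->|//].
by rewrite pushK //; apply: wmul_reduced.
Qed.

Lemma wmulA w1 w2 w3 : reduced w2 -> reduced w3 ->
  wmul w1 (wmul w2 w3) = wmul (wmul w1 w2) w3.
Proof.
move=> r2 r3; elim: w1 => //= i w1 ->.
by rewrite wmul_push //; apply: wmul_reduced.
Qed.

Lemma wmulw0 w : reduced w -> wmul w [::] = w.
Proof.
elim: w => //= i w IHw r; rewrite IHw ?push_cons //; exact: reduced_behead r.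
Qed.

Lemma rev_reduced w : reduced w -> reduced (rev w).
Proof.
by rewrite /reduced rev_sorted; congr is_true; apply: eq_sorted => i j;
   rewrite eq_sym.
Qed.

Lemma wmul_rev w w' : reduced w' -> wmul (rev w) (wmul w w') = w'.
Proof.
elim: w w' => //= i w IHw w' r'.
rewrite rev_cons /wmul -cats1 foldr_cat /= pushK; last exact: wmul_reduced.
exact: IHw.
Qed.

Definition freeZ2_one := @FreeZ2 [::] isT.
Definition freeZ2_mul (x y : freeZ2) : freeZ2 :=
  FreeZ2 (@wmul_reduced x y (valP y)).
Definition freeZ2_inv (x : freeZ2) : freeZ2 := FreeZ2 (rev_reduced (valP x)).
Definition freeZ2_gen i := @FreeZ2 [:: i] isT.

Lemma freeZ2_mulA : associative freeZ2_mul.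
Proof. by move=> x y z; apply: val_inj; apply: wmulA; apply: valP. Qed.

Lemma freeZ2_mul1 : left_id freeZ2_one freeZ2_mul.
Proof. by move=> x; apply: val_inj. Qed.

Lemma freeZ2_mulx1 : right_id freeZ2_one freeZ2_mul.
Proof. by move=> x; apply: val_inj; apply: wmulw0; apply: valP. Qed.

Lemma freeZ2_mulV : left_inverse freeZ2_one freeZ2_inv freeZ2_mul.
Proof.
move=> x; apply: val_inj => /=.
by rewrite -[X in wmul _ X](wmulw0 (valP x)) wmul_rev.
Qed.

Lemma freeZ2_invK : involutive freeZ2_inv.
Proof. by move=> x; apply: val_inj; apply: revK. Qed.

Lemma freeZ2_mulxV : right_inverse freeZ2_one freeZ2_inv freeZ2_mul.
Proof. by move=> x; rewrite -{1}[x]freeZ2_invK freeZ2_mulV. Qed.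

HB.instance Definition _ := isGroup.Build freeZ2
  freeZ2_mulA freeZ2_mul1 freeZ2_mulx1 freeZ2_mulV freeZ2_mulxV.

Lemma freeZ2_mulE (x y : freeZ2) : (x * y)%g = wmul x y :> seq 'I_n.
Proof. by []. Qed.

Lemma freeZ2_genK i : (freeZ2_gen i * freeZ2_gen i)%g = 1%g.
Proof. by apply: val_inj => /=; rewrite eqxx. Qed.

Lemma freeZ2_genV i : ((freeZ2_gen i)^-1)%g = freeZ2_gen i.
Proof. exact: val_inj. Qed.

Lemma freeZ2_ind (P : freeZ2 -> Prop) :
  P 1%g -> (forall i x, P x -> P (freeZ2_gen i * x)%g) -> forall x, P x.
Proof.
move=> P1 PM [w]; elim: w => [|i w IHw] r.
  by rewrite (_ : FreeZ2 r = 1%g) //; apply: val_inj.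
have r' := reduced_behead r.
rewrite (_ : FreeZ2 r = freeZ2_gen i * FreeZ2 r')%g; first exact/PM/IHw.
by apply: val_inj => /=; rewrite -push_cons.
Qed.

Lemma freeZ2_universal (H : groupType) (h : 'I_n -> H) :
  (forall i, h i * h i = 1)%g ->
  exists f : freeZ2 -> H,
    {morph f : x y / (x * y)%g} /\ (forall i, f (freeZ2_gen i) = h i).
Proof.
move=> hK; pose F := foldr (fun i y => (h i * y)%g) 1%g.
have Fpush i w : F (push i w) = (h i * F w)%g.
  case: w => //= j w; case: eqP => [->|//].
  by rewrite mulgA hK mul1g.
exists (fun x : freeZ2 => F x); split => [|i]; last exact: mulg1.
move=> x y; rewrite freeZ2_mulE.
elim: (fword x) => [|i w IHw] /=; first by rewrite mul1g.
by rewrite Fpush IHw mulgA.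
Qed.

Lemma freeZ2_unique (H : groupType) (f g : freeZ2 -> H) :
  {morph f : x y / (x * y)%g} -> {morph g : x y / (x * y)%g} ->
  (forall i, f (freeZ2_gen i) = g (freeZ2_gen i)) -> f =1 g.
Proof.
move=> fM gM fg.
have morph1 (k : freeZ2 -> H) : {morph k : x y / (x * y)%g} -> k 1%g = 1%g.
  by move=> kM; apply: (mulgI (k 1%g)); rewrite -kM !mulg1.
apply: freeZ2_ind => [|i x IHx].
  by rewrite !morph1.
by rewrite fM gM fg IHx.
Qed.

End FreeZ2.

Definition cauchy_complete (R : realType) (V : zmodType) (nrm : V -> R) :=
  forall x : nat -> V,
    (forall e : R, 0 < e -> exists N, forall j k, (N <= j)%N -> (N <= k)%N ->
       nrm (x j - x k) < e) ->
    exists l, forall e : R, 0 < e -> exists N, forall k, (N <= k)%N ->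
       nrm (x k - l) < e.

(* C*-algebras are unital here. The norm is a field of its own because the    *)
(* hierarchy of normed modules has no join with that of algebras.             *)

HB.mixin Record isCstarAlgebra (R : realType) A of GRing.Algebra R[i] A := {
  star : A -> A;
  starK : involutive star;
  starD : forall x y, star (x + y) = star x + star y;
  starZ : forall (c : R[i]) x, star (c *: x) = Num.conj c *: star x;
  starM : forall x y, star (x * y) = star y * star x;
  cnorm : A -> R;
  cnorm_eq0 : forall x, cnorm x = 0 -> x = 0;
  cnormD : forall x y, cnorm (x + y) <= cnorm x + cnorm y;
  cnormZ : forall (c : R[i]) x, (cnorm (c *: x))%:C%C = `|c| * (cnorm x)%:C%C;
  cnormM : forall x y, cnorm (x * y) <= cnorm x * cnorm y;
  cnorm_star : forall x, cnorm (star x * x) = cnorm x ^+ 2;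
  cnorm_complete : cauchy_complete cnorm
}.

#[short(type="cstarAlgType")]
HB.structure Definition CstarAlgebra (R : realType) :=
  { A of GRing.Algebra R[i] A & isCstarAlgebra R A }.

Definition dot_norm (R : realType) (V : lmodType R[i])
    (dot : {dot V for Num.conj}) (x : V) : R :=
  Num.sqrt (complex.Re (dot x x)).

Record hilbertSpace (R : realType) := HilbertSpace {
  hilbert_sort :> lmodType R[i];
  inner : {dot hilbert_sort for Num.conj};
  hilbert_complete : cauchy_complete (dot_norm inner)
}.

Definition hnorm (R : realType) (H : hilbertSpace R) (x : H) : R :=
  dot_norm (inner H) x.

Section GroupCstar.
Variables (R : realType) (G : groupType).
Local Notation C := R[i].

(* Operators [pi g] that are isometric and invertible, with inverse           *)
(* [pi g^-1], are unitary.                                                    *)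
Record unitary_rep (H : hilbertSpace R) := UnitaryRep {
  rep :> G -> {linear H -> H};
  rep1 : forall x, rep 1%g x = x;
  repM : forall g h x, rep (g * h)%g x = rep g (rep h x);
  rep_isometry : forall g x y, inner H (rep g x) (rep g y) = inner H x y
}.

(* The group algebra C[G] consists of the finitely supported functions on G.  *)
Definition galg := {fsfun G -> C with 0}.

Definition galg_eval (V : lmodType C) (u : G -> V) (f : galg) : V :=
  \sum_(g <- finsupp f) f g *: u g.

(* M is an upper bound of the norms of all the operators pi(f), where pi runs *)
(* over the unitary representations of G.                                     *)
Definition rep_bound (f : galg) (M : R) := 0 <= M /\
  forall (H : hilbertSpace R) (pi : unitary_rep H) (x : H),
    hnorm (galg_eval (fun g => pi g x) f) <= M * hnorm x.

(* A is the completion of C[G] in the norm |f| = sup_pi |pi(f)|.              *)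
Record is_full_group_cstar (A : cstarAlgType R) (u : G -> A) : Prop := {
  fgc_1 : u 1%g = 1;
  fgc_M : forall g h, u (g * h)%g = u g * u h;
  fgc_star : forall g, star (u g) = u (g^-1)%g;
  fgc_dense : forall x (e : R), 0 < e ->
    exists f, cnorm (x - galg_eval u f) < e;
  fgc_norm_ub : forall f, rep_bound f (cnorm (galg_eval u f));
  fgc_norm_lub : forall f M, rep_bound f M -> cnorm (galg_eval u f) <= M
}.

Record fullGroupCstar := FullGroupCstar {
  fgc_alg :> cstarAlgType R;
  fgc_embed : G -> fgc_alg;
  fgcP : is_full_group_cstar fgc_embed
}.

End GroupCstar.

Section OperatorSystems.
Variable R : realType.
Implicit Types A B : cstarAlgType R.

Record opSystem A := OpSystem {
  os_set : set A;
  os_1 : os_set 1;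
  os_lin : forall (c : R[i]) x y, os_set x -> os_set y -> os_set (c *: x + y);
  os_star : forall x, os_set x -> os_set (star x)
}.

Definition os_pred A (S : opSystem A) : {pred A} := [pred x | `[< os_set S x >]].

Lemma os_predP A (S : opSystem A) x : reflect (os_set S x) (x \in os_pred S).
Proof. exact: asboolP. Qed.

Lemma os_pred_closed A (S : opSystem A) : GRing.subsemimod_closed (os_pred S).
Proof.
have S0 : os_set S 0.
  rewrite (_ : 0 = -1 *: 1 + 1); last by rewrite scaleN1r addNr.
  by apply: os_lin; apply: os_1.
split; first split; first exact/os_predP.
- move=> x y /os_predP Sx /os_predP Sy; apply/os_predP.
  by rewrite -[x]scale1r; apply: os_lin.
- move=> c x /os_predP Sx; apply/os_predP.
  by rewrite -[_ *: _]addr0; apply: os_lin.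
Qed.

Record os_type A (S : opSystem A) :=
  OsType { os_val : A; _ : os_val \in os_pred S }.
HB.instance Definition _ A (S : opSystem A) := [isSub for @os_val A S].
HB.instance Definition _ A (S : opSystem A) := [Choice of os_type S by <:].
HB.instance Definition _ A (S : opSystem A) :=
  GRing.SubChoice_isSubLmodule.Build R[i] A (os_pred S) (os_type S)
    (os_pred_closed S).

(* The positive elements of the C*-algebra M_p(A) are the Y^* Y.              *)
Definition psd A p (X : 'M[A]_p) :=
  exists Y : 'M[A]_p, X = (map_mx star Y)^T *m Y.

Definition os_psd A (S : opSystem A) p (X : 'M[os_type S]_p) :=
  psd (map_mx val X).

Definition is_cp A B (S : opSystem A) (T : opSystem B)
    (phi : {linear os_type S -> os_type T}) :=
  forall p (X : 'M[os_type S]_p), os_psd X -> os_psd (map_mx phi X).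

Definition cp_pure A B (S : opSystem A) (T : opSystem B)
    (phi : {linear os_type S -> os_type T}) :=
  is_cp phi /\
  forall theta omega : {linear os_type S -> os_type T},
    is_cp theta -> is_cp omega -> (forall x, theta x + omega x = phi x) ->
    exists s : R, [/\ 0 <= s <= 1,
      forall x, theta x = s%:C%C *: phi x &
      forall x, omega x = (1 - s)%:C%C *: phi x].

Definition os_full A : opSystem A :=
  @OpSystem A setT I (fun _ _ _ _ _ => I) (fun _ _ => I).

Lemma os_fullP A (x : A) : x \in os_pred (os_full A).
Proof. exact/os_predP. Qed.

Section Inclusion.
Variables (A : cstarAlgType R) (S : opSystem A).

Definition os_incl (x : os_type S) : os_type (os_full A) :=
  OsType (os_fullP (os_val x)).

Lemma os_incl_linear : linear os_incl.
Proof.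
move=> c x y; apply: val_inj.
rewrite (linearP (val : os_type (os_full A) -> A)).
exact: (linearP (val : os_type S -> A)).
Qed.

HB.instance Definition _ :=
  GRing.isLinear.Build R[i] (os_type S) (os_type (os_full A)) _ os_incl
    os_incl_linear.

End Inclusion.
End OperatorSystems.

Section NC.
Variables (R : realType) (n : nat) (A : fullGroupCstar R (freeZ2 n)).

Definition nc_gen (j : 'I_n) : A := fgc_embed A (freeZ2_gen j).

Definition nc_set : set A :=
  [set x | exists (a : R[i]) (b : 'I_n -> R[i]),
     x = a *: 1 + \sum_(j < n) b j *: nc_gen j].

Lemma nc_set1 : nc_set 1.
Proof.
exists 1, (fun=> 0); rewrite scale1r big1 ?addr0 // => j _.
exact: scale0r.
Qed.

Lemma nc_set_lin (c : R[i]) (x y : A) :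
  nc_set x -> nc_set y -> nc_set (c *: x + y).
Proof.
move=> [a [b ->]] [a' [b' ->]]; exists (c * a + a'), (fun j => c * b j + b' j).
rewrite scalerDr scalerA scaler_sumr addrACA scalerDl; congr (_ + _).
by rewrite -big_split; apply: eq_bigr => j _; rewrite /= scalerA scalerDl.
Qed.

Lemma nc_set_star (x : A) : nc_set x -> nc_set (star x).
Proof.
have star1 : star (1 : A) = 1 by rewrite -(fgc_1 (fgcP A)) (fgc_star (fgcP A)) invg1.
have star0 : star (0 : A) = 0.
  by apply: (addrI (star (0 : A))); rewrite -starD !addr0.
move=> [a [b ->]]; exists (Num.conj a), (fun j => Num.conj (b j)).
rewrite starD starZ star1; congr (_ + _).
rewrite (big_morph _ (@starD R A) star0); apply: eq_bigr => j _.
by rewrite starZ /nc_gen (fgc_star (fgcP A)) freeZ2_genV.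
Qed.

Definition NC : opSystem A := OpSystem nc_set1 nc_set_lin nc_set_star.

Definition iota_e : {linear os_type NC -> os_type (os_full A)} := @os_incl R A NC.

End NC.

(* Main.v *)
Require Import Defs.
From HB Require Import structures.
From mathcomp Require Import all_boot all_order all_algebra finmap.
From mathcomp Require Import all_classical all_reals.
From mathcomp Require Import complex.
From mathcomp Require Import ring lra zify.

(* If theta + omega = iota with both summands completely positive, then       *)
(* theta(1 +- v_j) is dominated by 1 +- v_j, hence killed by 1 -+ v_j. So     *)
(* theta(v_j) = a v_j with a = theta(1), and taking adjoints a commutes with  *)
(* every v_j: it is central. It remains to see that C*(Z/2 * ... * Z/2) has   *)
(* trivial centre for n >= 3.                                                 *)
(*                                                                            *)
(* Let pi be a representation on H and xi in H. On H (x) l^2(Z/N) (x) C^2,    *)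
(* let v_0 and v_1 act by the reflections x |-> w - 1 - x and x |-> w - x of  *)
(* Z/N, twisted by pi on one layer and untwisted on the other. Then the       *)
(* vectors xi (x) 1_[0,w) in the two layers are almost invariant multiples of *)
(* pi and of the trivial representation. This leaves v_2 free outside [0, w): *)
(* it can be chosen to swap the two layers on [w, 2w) and to be a reflection  *)
(* at two further sites, so that one vector is isolated up to scalars by      *)
(* elements of the group algebra and has both almost invariant vectors in its *)
(* span. A central element acts on that span by a scalar, so pi(a) xi is the  *)
(* multiple of xi given by the trivial representation.                        *)

Set Implicit Arguments.
Unset Strict Implicit.
Unset Printing Implicit Defensive.

Import Order.TTheory GRing.Theory Num.Theory.

Local Open Scope ring_scope.

(** Two facts carry the proof. The first is that the positive cone is proper:
    [star x * x + star y * y = 0] forces [x = 0] ([sum_star_eq0]). Hence a summand [theta] of the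
    inclusion inherits the right annihilators of [1 + v_j] and [1 - v_j], which turns [theta] into
    multiplication by the central element [a = theta(1)] ([summand_gen]). Once [a] is a scalar,
    [scalar_star_ge0] applied to [theta(1)] and [omega(1)] puts it in [[0,1]].

    The second is that the centre is trivial ([central_scalar]). The norm is a supremum over unitary
    representations, so it suffices that an element [s] of the group algebra close to [a] acts in
    every [pi] almost as the scalar by which it acts in the trivial representation
    ([rep_near_augmentation]). In [link_rep] the product of [1 - shifted_gen] and [1 - v_2] maps
    everything to multiples of [base] ([base_isolated]), so an operator that almost commutes with
    the group has [base] as an approximate eigenvector. The points of both layers over [[0,w)] lie
    in the orbit of [base] ([base_orbit]), so both spread vectors share its approximate eigenvalue
    ([spread_near_eigenvector]). On one layer this eigenvalue is compared with [pi(s) xi], on the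
    other with the augmentation of [s]. The error of almost invariance is bounded while the spread
    vectors have norm [sqrt w |xi|], so it disappears for large [w]. *)

(** * Modulus, real and imaginary parts of complex numbers *)

Section ComplexModulus.
Variable R : realType.
Implicit Types c d : R[i].

Lemma normc_normr c : (Normc.normc c)%:C%C = `|c|.
Proof. by case: c. Qed.

Lemma normc_ge0 c : 0 <= Normc.normc c.
Proof. by rewrite -ler0c normc_normr normr_ge0. Qed.

Lemma normc_real (r : R) : Normc.normc r%:C%C = `|r|.
Proof. by rewrite /= expr0n /= addr0 sqrtr_sqr. Qed.

Lemma conj_real (r : R) : Num.conj r%:C%C = r%:C%C.
Proof. exact: conjc_real. Qed.

Lemma ReZ (r : R) c : complex.Re (r%:C%C * c) = r * complex.Re c.
Proof. by case: c => a b /=; rewrite mul0r subr0. Qed.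

Lemma Re_ge0 c : 0 <= c -> 0 <= complex.Re c.
Proof. by rewrite lecE => /andP[]. Qed.

Lemma normc_ge_Re c : `|complex.Re c| <= Normc.normc c.
Proof.
by case: c => a b /=; rewrite -sqrtr_sqr ler_wsqrtr // lerDl sqr_ge0.
Qed.

Lemma normc_ge_Im c : `|complex.Im c| <= Normc.normc c.
Proof.
by case: c => a b /=; rewrite -sqrtr_sqr ler_wsqrtr // lerDr sqr_ge0.
Qed.

Lemma normc_le c : Normc.normc c <= `|complex.Re c| + `|complex.Im c|.
Proof.
case: c => a b /=; rewrite -ler_sqr ?nnegrE ?sqrtr_ge0 ?addr_ge0 //.
rewrite sqr_sqrtr ?addr_ge0 ?sqr_ge0 // sqrrD !real_normK ?num_real //.
by rewrite addrAC lerDl mulrn_wge0 // mulr_ge0.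
Qed.

End ComplexModulus.

(** * Hilbert spaces *)

Section HilbertNorm.
Variables (R : realType) (H : hilbertSpace R).
Implicit Types (x y z : H) (c : R[i]).
Local Notation "''[' x , y ]" := (inner H x y) : ring_scope.

Lemma inner_ge0 x : 0 <= '[x, x].
Proof. exact: dnorm_ge0. Qed.

Lemma innerC x y : '[x, y] = Num.conj '[y, x].
Proof. by rewrite hermC expr0 mul1r. Qed.

Lemma hnorm_ge0 x : 0 <= hnorm x.
Proof. exact: Num.Theory.sqrtr_ge0. Qed.

Lemma hnorm_sqrE x : hnorm x ^+ 2 = complex.Re '[x, x].
Proof. by rewrite Num.Theory.sqr_sqrtr //; apply/Re_ge0/inner_ge0. Qed.

Lemma innerE x : '[x, x] = (hnorm x ^+ 2)%:C%C.
Proof. by rewrite hnorm_sqrE RRe_real // ger0_real // inner_ge0. Qed.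

Lemma hnorm0 : hnorm (0 : H) = 0.
Proof. by rewrite /hnorm /dot_norm linear0 /= sqrtr0. Qed.

Lemma hnormZ c x : hnorm (c *: x) = Normc.normc c * hnorm x.
Proof.
apply/eqP; rewrite -(@eqrXn2 _ 2) ?hnorm_ge0 ?mulr_ge0 ?normc_ge0 ?hnorm_ge0 //.
apply/eqP/complexI; rewrite -innerE dnormZ innerE -normc_normr exprMn.
by rewrite -rmorphXn -rmorphM.
Qed.

Lemma hnorm_opp x : hnorm (- x) = hnorm x.
Proof. by rewrite /hnorm /dot_norm linearNl linearNr opprK. Qed.

Lemma hnorm_eq0 x : hnorm x = 0 -> x = 0.
Proof.
by move=> x0; apply/eqP; rewrite -(dnorm_eq0 (inner H)) innerE x0 expr0n.
Qed.

Lemma hnormD_sqr x y :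
  hnorm (x + y) ^+ 2 = hnorm x ^+ 2 + hnorm y ^+ 2 + 2 * complex.Re '[x, y].
Proof.
rewrite !hnorm_sqrE dnormD.
case: '[x, x] => a b; case: '[y, y] => c d; case: '[x, y] => e f /=.
by rewrite mulrDl mul1r.
Qed.

(* Expand [0 <= | |y| x - |x| y |^2]. *)
Lemma Re_inner_le x y : complex.Re '[x, y] <= hnorm x * hnorm y.
Proof.
have [/hnorm_eq0-> | x0] := eqVneq (hnorm x) 0.
  by rewrite linear0l hnorm0 mul0r.
have [/hnorm_eq0-> | y0] := eqVneq (hnorm y) 0.
  by rewrite linear0r hnorm0 mulr0.
set a := hnorm x in x0 *; set b := hnorm y in y0 *.
have ab0 : 0 < a * b by rewrite lt_def mulf_neq0 // mulr_ge0 // hnorm_ge0.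
have := sqr_ge0 (hnorm (b%:C%C *: x + (- a)%:C%C *: y)).
rewrite hnormD_sqr !hnormZ !exprMn -/a -/b.
rewrite !normc_real !real_normK ?num_real // sqrrN.
rewrite linearZl_LR linearZr_LR /= conj_real !ReZ.
by move=> ge0; rewrite -(ler_pM2l ab0); nra.
Qed.

Lemma ler_hnormD x y : hnorm (x + y) <= hnorm x + hnorm y.
Proof.
rewrite -ler_sqr ?nnegrE ?addr_ge0 ?hnorm_ge0 //.
by rewrite hnormD_sqr; have := Re_inner_le x y; nra.
Qed.

Lemma ler_hnormB x y : hnorm (x - y) <= hnorm x + hnorm y.
Proof. by rewrite -(hnorm_opp y) ler_hnormD. Qed.

Lemma hdistC x y : hnorm (x - y) = hnorm (y - x).
Proof. by rewrite -hnorm_opp opprB. Qed.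

Lemma hdistD x y z : hnorm (x - z) <= hnorm (x - y) + hnorm (y - z).
Proof.
by rewrite (_ : x - z = (x - y) + (y - z)) ?ler_hnormD // addrA subrK.
Qed.

Lemma hnorm_sum (I : Type) (r : seq I) (P : pred I) (F : I -> H) :
  hnorm (\sum_(i <- r | P i) F i) <= \sum_(i <- r | P i) hnorm (F i).
Proof.
elim/big_rec2: _ => [|i y x _ le_xy]; first by rewrite hnorm0.
by apply: le_trans (ler_hnormD _ _) _; rewrite lerD2l.
Qed.

Lemma isometry_hnorm (K : hilbertSpace R) (f : H -> K) :
    (forall x y, inner K (f x) (f y) = '[x, y]) ->
  forall x, hnorm (f x) = hnorm x.
Proof. by move=> fI x; rewrite /hnorm /dot_norm fI. Qed.

End HilbertNorm.

(** * Finite powers of a Hilbert space *)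

Section HilbertPower.
Variables (R : realType) (H : hilbertSpace R) (I : finType).
Local Notation V := {ffun I -> H}.
Implicit Types F G : V.

Definition powdot F G : R[i] := \sum_i inner H (F i) (G i).

Lemma powdot_additivel G : zmod_morphism (powdot^~ G).
Proof.
move=> F F'; rewrite /powdot -sumrB; apply: eq_bigr => i _.
by rewrite !ffunE linearBl.
Qed.

Lemma powdot_additiver F : zmod_morphism (powdot F).
Proof.
move=> G G'; rewrite /powdot -sumrB; apply: eq_bigr => i _.
by rewrite !ffunE linearBr.
Qed.

Lemma powdot_scalablel G : scalable_for *%R (powdot^~ G).
Proof.
move=> c F; rewrite /powdot mulr_sumr; apply: eq_bigr => i _.
by rewrite ffunE linearZl_LR.
Qed.

Lemma powdot_scalabler F : scalable_for (Num.conj \; *%R) (powdot F).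
Proof.
move=> c G; rewrite /powdot /= mulr_sumr; apply: eq_bigr => i _.
by rewrite ffunE linearZr_LR.
Qed.

HB.instance Definition _ := @isBilinear.Build R[i] V V R[i] *%R
  (Num.conj \; *%R) powdot powdot_additivel powdot_additiver
  powdot_scalablel powdot_scalabler.

Lemma powdot_hermitian F G : powdot F G = (-1) ^+ false * Num.conj (powdot G F).
Proof.
by rewrite mul1r rmorph_sum; apply: eq_bigr => i _; rewrite innerC.
Qed.

HB.instance Definition _ := @isHermitianSesquilinear.Build R[i] V false
  Num.conj powdot powdot_hermitian.

Lemma powdot_gt0 F : F != 0 -> 0 < powdot F F.
Proof.
move=> F0; have [i Fi0] : exists i, F i != 0.
  apply/existsP; apply: contraR F0; rewrite negb_exists => /forallP F0.
  apply/eqP/ffunP => i; rewrite ffunE; apply/eqP.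
  by have := F0 i; rewrite negbK.
rewrite /powdot (bigD1 i) //= ltr_pwDl ?dnorm_gt0 //.
by apply: sumr_ge0 => j _; apply: inner_ge0.
Qed.

HB.instance Definition _ := @isDotProduct.Build R[i] V powdot powdot_gt0.

Lemma powdot_normE F :
  dot_norm powdot F ^+ 2 = \sum_i hnorm (F i) ^+ 2.
Proof.
rewrite sqr_sqrtr; last by apply/Re_ge0/dnorm_ge0.
by rewrite /= /powdot raddf_sum; apply: eq_bigr => i _; rewrite hnorm_sqrE.
Qed.

Lemma coord_le_powdot F i : hnorm (F i) <= dot_norm powdot F.
Proof.
rewrite -ler_sqr ?nnegrE ?hnorm_ge0 ?sqrtr_ge0 // powdot_normE (bigD1 i) //=.
by rewrite lerDl sumr_ge0 // => j _; apply: sqr_ge0.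
Qed.

Lemma powdot_le_sum F : dot_norm powdot F <= \sum_i hnorm (F i).
Proof.
rewrite -ler_sqr ?nnegrE ?sqrtr_ge0 ?sumr_ge0 //; last first.
  by move=> *; apply: hnorm_ge0.
rewrite powdot_normE.
suff [] : \sum_i hnorm (F i) ^+ 2 <= (\sum_i hnorm (F i)) ^+ 2 /\
    0 <= \sum_i hnorm (F i) by [].
elim/big_rec2: _ => [|i y x _ [le_xy y0]]; first by rewrite expr0n.
by have := hnorm_ge0 (F i); split; nra.
Qed.

Lemma powdot_complete : cauchy_complete (dot_norm powdot).
Proof.
move=> x xC.
have /choice[l lP] : forall i, exists l : H, forall e : R, 0 < e ->
    exists N, forall k, (N <= k)%N -> hnorm (x k i - l) < e.
  move=> i; have := @hilbert_complete R H (fun k => x k i); apply=> e e0.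
  have [N NP] := xC e e0; exists N => j k Nj Nk.
  apply: le_lt_trans (NP j k Nj Nk).
  by have := coord_le_powdot (x j - x k) i; rewrite !ffunE.
exists [ffun i => l i] => e e0.
(* The [+ 1] makes the sum of the coordinate errors strictly less than [e], also for empty [I]. *)
have e'0 : 0 < e / (#|I|%:R + 1) by rewrite divr_gt0 // ltr_pwDr.
have /choice[N NP] : forall i, exists N, forall k, (N <= k)%N ->
    hnorm (x k i - l i) < e / (#|I|%:R + 1).
  by move=> i; apply: lP.
exists (\max_i N i) => k Nk; apply: le_lt_trans (powdot_le_sum _) _.
apply: (@le_lt_trans _ _ (\sum_(i : I) e / (#|I|%:R + 1))).
  apply: ler_sum => i _; rewrite !ffunE ltW // NP //.
  exact: leq_trans (leq_bigmax i) Nk.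
rewrite sumr_const -[_ *+ _]mulr_natl mulrCA gtr_pMr //.
rewrite ltr_pdivrMr ?ltr_pwDr //.
by rewrite mul1r ltrDl.
Qed.

Definition hilbert_pow : hilbertSpace R := HilbertSpace powdot_complete.

Lemma inner_powE (F G : hilbert_pow) :
  inner hilbert_pow F G = \sum_i inner H ((F : V) i) ((G : V) i).
Proof. by []. Qed.

Lemma hnorm_powE (F : hilbert_pow) :
  hnorm F ^+ 2 = \sum_i hnorm ((F : V) i) ^+ 2.
Proof. exact: powdot_normE. Qed.

Lemma powD (F G : hilbert_pow) i :
  ((F + G : hilbert_pow) : V) i = (F : V) i + (G : V) i.
Proof. exact: ffunE. Qed.

Lemma powN (F : hilbert_pow) i : ((- F : hilbert_pow) : V) i = - (F : V) i.
Proof. exact: ffunE. Qed.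

Lemma powZ (c : R[i]) (F : hilbert_pow) i :
  ((c *: F : hilbert_pow) : V) i = c *: (F : V) i.
Proof. exact: ffunE. Qed.

Lemma pow_sum (J : Type) (r : seq J) (P : pred J) (F : J -> hilbert_pow) i :
  ((\sum_(j <- r | P j) F j : hilbert_pow) : V) i =
  \sum_(j <- r | P j) (F j : V) i.
Proof. exact: sum_ffunE. Qed.

End HilbertPower.

(** * Representations of the free product *)

Section RepOfInvolutions.
Variables (R : realType) (n : nat) (H : hilbertSpace R).
Variable V : 'I_n -> {linear H -> H}.
Hypothesis VK : forall j x, V j (V j x) = x.
Hypothesis V_isometry : forall j x y, inner H (V j x) (V j y) = inner H x y.

Definition word_op : seq 'I_n -> {linear H -> H} :=
  foldr (fun j (F : {linear H -> H}) => V j \o F : {linear H -> H}) idfun.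

(** Cancelling two equal letters is harmless because [V j] is an involution; this is what makes
    [word_op] multiplicative. *)
Lemma word_op_push j w x : word_op (push j w) x = V j (word_op w x).
Proof. by case: w => //= k w; case: eqP => [->|//] /=; rewrite VK. Qed.

Lemma word_op1 x : word_op (1%g : freeZ2 n) x = x.
Proof. by []. Qed.

Lemma word_opM (g h : freeZ2 n) x :
  word_op (g * h)%g x = word_op g (word_op h x).
Proof.
rewrite freeZ2_mulE; elim: (fword g) => //= j w IHw.
by rewrite word_op_push IHw.
Qed.

Lemma word_op_isometry (g : freeZ2 n) x y :
  inner H (word_op g x) (word_op g y) = inner H x y.
Proof. by elim: (fword g) => //= j w IHw; rewrite V_isometry. Qed.

Definition involutions_rep : unitary_rep (freeZ2 n) H :=
  UnitaryRep word_op1 word_opM word_op_isometry.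

Lemma involutions_rep_gen j x : involutions_rep (freeZ2_gen j) x = V j x.
Proof. by []. Qed.

End RepOfInvolutions.

(** * Operators permuting the coordinates of a power *)

Section Monomial.
Variables (R : realType) (H : hilbertSpace R) (I : finType).
Variables (s : I -> I) (W : I -> {linear H -> H}).
Local Notation K := (hilbert_pow H I).

Definition monomial (F : K) : K := [ffun i => W i ((F : {ffun I -> H}) (s i))].

Lemma monomial_linear : linear monomial.
Proof. by move=> c F G; apply/ffunP => i; rewrite !ffunE linearP. Qed.

HB.instance Definition _ := GRing.isLinear.Build R[i] K K _ monomial
  monomial_linear.

Hypothesis sK : involutive s.

Lemma monomialK : (forall i x, W i (W (s i) x) = x) -> involutive monomial.
Proof. by move=> WK F; apply/ffunP => i; rewrite !ffunE WK sK. Qed.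

Lemma monomial_isometry :
    (forall i x y, inner H (W i x) (W i y) = inner H x y) ->
  forall F G, inner K (monomial F) (monomial G) = inner K F G.
Proof.
move=> W_isometry F G; rewrite !inner_powE [RHS](reindex s) /=.
  by apply: eq_bigr => i _; rewrite !ffunE W_isometry.
by exists s => i _; apply: sK.
Qed.

End Monomial.

(** * Reflections in a hyperplane *)

Section Reflection.
Variables (R : realType) (H : hilbertSpace R) (x : H).

(* This is the identity when [x = 0]. *)
Definition reflection (y : H) : H := y - (2 * inner H y x / inner H x x) *: x.

Lemma reflection_linear : linear reflection.
Proof.
move=> c y z; rewrite /reflection linearDl linearZl_LR /= scalerBr scalerA.
rewrite addrACA -opprD -scalerDl; congr (_ - _ *: _); ring.
Qed.

HB.instance Definition _ := GRing.isLinear.Build R[i] H H _ reflection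
  reflection_linear.

Lemma inner_self_neq0 : x != 0 -> inner H x x != 0.
Proof. by rewrite dnorm_eq0. Qed.

Lemma reflection_self : reflection x = - x.
Proof.
rewrite /reflection; have [->|x0] := eqVneq x 0.
  by rewrite scaler0 subr0 oppr0.
rewrite mulfK ?inner_self_neq0 // -{1}[x]scale1r -scalerBl.
by rewrite (_ : 1 - 2 = -1) ?scaleN1r //; ring.
Qed.

Lemma reflectionK : involutive reflection.
Proof.
move=> y; rewrite {2}/reflection linearB linearZ /= reflection_self.
by rewrite scalerN opprK /reflection subrK.
Qed.

Lemma reflection_isometry y z :
  inner H (reflection y) (reflection z) = inner H y z.
Proof.
have [x0|x0] := eqVneq x 0; first by rewrite /reflection x0 !scaler0 !subr0.
rewrite /reflection !linearBl !linearBr /= !linearZl_LR !linearZr_LR /=.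
rewrite !rmorphM !fmorphV /= -!innerC rmorph_nat.
have := inner_self_neq0 x0; move: (inner H x x) (inner H y x) (inner H x z).
by move=> a b c a0; field.
Qed.

End Reflection.

(** * The full group C*-algebra *)

Section CstarNorm.
Variables (R : realType) (A : cstarAlgType R).
Implicit Types (x y : A) (c : R[i]).

Lemma cnormZE c x : cnorm (c *: x) = Normc.normc c * cnorm x.
Proof. by apply: complexI; rewrite cnormZ -normc_normr -rmorphM. Qed.

Lemma cnorm0 : cnorm (0 : A) = 0.
Proof. by rewrite -(scale0r (0 : A)) cnormZE Normc.normc0 mul0r. Qed.

Lemma cnormN x : cnorm (- x) = cnorm x.
Proof.
rewrite -scaleN1r cnormZE -(rmorphN1 (real_complex R)) normc_real.
by rewrite normrN1 mul1r.
Qed.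

Lemma cnorm_ge0 x : 0 <= cnorm x.
Proof. by have := cnormD x (- x); rewrite cnormN subrr cnorm0; lra. Qed.

Lemma cnormB x y : cnorm (x - y) <= cnorm x + cnorm y.
Proof. by rewrite -(cnormN y) cnormD. Qed.

Lemma cdistC x y : cnorm (x - y) = cnorm (y - x).
Proof. by rewrite -cnormN opprB. Qed.

Lemma cdistD x y z : cnorm (x - z) <= cnorm (x - y) + cnorm (y - z).
Proof. by rewrite (_ : x - z = (x - y) + (y - z)) ?cnormD // addrA subrK. Qed.

Lemma star0 : star (0 : A) = 0.
Proof. by apply: (addrI (star (0 : A))); rewrite -starD !addr0. Qed.

Lemma starN x : star (- x) = - star x.
Proof. by apply: (addrI (star x)); rewrite -starD !subrr star0. Qed.

Lemma starB x y : star (x - y) = star x - star y.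
Proof. by rewrite starD starN. Qed.

Lemma star1 : star (1 : A) = 1.
Proof. by rewrite -[RHS]starK -[star 1 in RHS]mulr1 starM starK mulr1. Qed.

Lemma star_sum (I : Type) (r : seq I) (F : I -> A) :
  star (\sum_(i <- r) F i) = \sum_(i <- r) star (F i).
Proof. exact: (big_morph _ (@starD R A) star0). Qed.

Lemma cnorm_le_star x : cnorm x <= cnorm (star x).
Proof.
have [->|x0] := eqVneq x 0; first by rewrite star0.
have x_gt0 : 0 < cnorm x.
  by rewrite lt_def cnorm_ge0 andbT; apply: contra x0 => /eqP/cnorm_eq0->.
by rewrite -(ler_pM2r x_gt0) -expr2 -cnorm_star cnormM.
Qed.

Lemma cnormS x : cnorm (star x) = cnorm x.
Proof.
by apply/le_anti; rewrite cnorm_le_star -{2}(starK x) cnorm_le_star.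
Qed.

End CstarNorm.

(** * Elements of the group algebra and their action *)

Section GroupPolynomials.
Variables (R : realType) (G : groupType).
Local Notation C := R[i].
(* The elements of the group algebra as formal sums, possibly with repeated   *)
(* terms, so that products and adjoints are plain list operations.            *)
Local Notation gpoly := (seq (C * G)).
Implicit Types (s t : gpoly) (c : C) (g h : G).

Definition geval (V : lmodType C) (u : G -> V) s : V :=
  \sum_(p <- s) p.1 *: u p.2.

Definition gmul s t : gpoly :=
  [seq (p.1 * q.1, (p.2 * q.2)%g) | p <- s, q <- t].
Definition gstar s : gpoly := [seq (Num.conj p.1, (p.2^-1)%g) | p <- s].
Definition gscale c s : gpoly := [seq (c * p.1, p.2) | p <- s].

Lemma geval_cat (V : lmodType C) (u : G -> V) s t :
  geval u (s ++ t) = geval u s + geval u t.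
Proof. exact: big_cat. Qed.

Lemma geval_scale (V : lmodType C) (u : G -> V) c s :
  geval u (gscale c s) = c *: geval u s.
Proof.
by rewrite /geval big_map scaler_sumr; apply: eq_bigr => p _; rewrite scalerA.
Qed.

Lemma geval1 (V : lmodType C) (u : G -> V) c g : geval u [:: (c, g)] = c *: u g.
Proof. by rewrite /geval big_seq1. Qed.

Lemma galg_eval_sub (V : lmodType C) (u : G -> V) (f : galg R G)
    (D : {fset G}) :
  (finsupp f `<=` D)%fset -> galg_eval u f = \sum_(g <- D) f g *: u g.
Proof.
move=> fD; by apply: big_fset_incl => // g _ /fsfun_dflt->; rewrite scale0r.
Qed.

Lemma gpoly_galg s :
  exists f : galg R G, forall (V : lmodType C) (u : G -> V),
    galg_eval u f = geval u s.
Proof.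
elim: s => [|[c g] s [f fP]].
  by exists [fsfun] => V u; rewrite /galg_eval finsupp0 /geval !big_nil.
pose D := (g |` finsupp f)%fset.
exists [fsfun h in D => f h + (if h == g then c else 0)] => V u.
rewrite (@galg_eval_sub _ _ _ D); last first.
  by apply/fsubsetP => h; rewrite mem_finsupp fsfunE; case: ifP; rewrite ?eqxx.
rewrite /geval big_cons -/(geval u s) -fP.
rewrite (@galg_eval_sub _ _ f D) ?fsubsetUr //.
rewrite (eq_big_seq (fun h => (if h == g then c else 0) *: u h + f h *: u h)).
  rewrite big_split /=; congr (_ + _).
  rewrite (big_fsetD1 g) ?fsetU11 //= eqxx big1_fset ?addr0 // => h.
  by rewrite in_fsetD1 => /andP[/negPf-> _] _; rewrite scale0r.
by move=> h hD; rewrite fsfunE hD scalerDl addrC.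
Qed.

Lemma galg_gpoly (f : galg R G) :
  exists s, forall (V : lmodType C) (u : G -> V), geval u s = galg_eval u f.
Proof.
by exists [seq (f g, g) | g <- finsupp f] => V u; rewrite /geval big_map.
Qed.

Section RepOperators.
Variables (H : hilbertSpace R) (pi : unitary_rep G H).
Implicit Types x y : H.

Definition rep_op s x : H := geval (fun g => pi g x) s.

Lemma rep_op_linear s : linear (rep_op s).
Proof.
move=> c x y; rewrite /rep_op /geval scaler_sumr -big_split.
by apply: eq_bigr => p _; rewrite /= linearP scalerDr !scalerA mulrC.
Qed.

HB.instance Definition _ s := GRing.isLinear.Build C H H _ (rep_op s)
  (rep_op_linear s).

Lemma rep_opM s t x : rep_op (gmul s t) x = rep_op s (rep_op t x).
Proof.
rewrite /rep_op /geval big_allpairs_dep; apply: eq_bigr => p _.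
rewrite linear_sum scaler_sumr; apply: eq_bigr => q _ /=.
by rewrite linearZ scalerA repM.
Qed.

Lemma rep_unitary g x y : inner H (pi g x) y = inner H x (pi (g^-1)%g y).
Proof. by rewrite -(rep_isometry pi (g^-1)%g) -repM mulVg rep1. Qed.

Lemma rep_hnorm g x : hnorm (pi g x) = hnorm x.
Proof. by apply: isometry_hnorm => {}x y; apply: rep_isometry. Qed.

Lemma rep_op_star s x y :
  inner H (rep_op s x) y = inner H x (rep_op (gstar s) y).
Proof.
rewrite /rep_op /geval big_map linear_sumlz linear_sumr; apply: eq_bigr => p _.
by rewrite linearZl_LR linearZr_LR /= conjCK rep_unitary.
Qed.

End RepOperators.

Section FullCstar.
Variable A : fullGroupCstar R G.
Local Notation u := (fgc_embed A).
Implicit Types x y : A.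

Lemma fgc_embed1 : u 1%g = 1. Proof. exact: fgc_1 (fgcP A). Qed.

Lemma fgc_embedM g h : u (g * h)%g = u g * u h.
Proof. exact: fgc_M (fgcP A) g h. Qed.

Lemma geval_mul s t : geval u (gmul s t) = geval u s * geval u t.
Proof.
rewrite /geval big_allpairs_dep mulr_suml; apply: eq_bigr => p _.
rewrite mulr_sumr; apply: eq_bigr => q _.
by rewrite fgc_embedM -scalerAl -scalerAr scalerA.
Qed.

Lemma geval_star s : geval u (gstar s) = star (geval u s).
Proof.
rewrite /geval big_map star_sum; apply: eq_bigr => p _.
by rewrite starZ (fgc_star (fgcP A)).
Qed.

Lemma gpoly_dense x (e : R) : 0 < e -> exists s, cnorm (x - geval u s) < e.
Proof.
move=> e0; have [f fP] := fgc_dense (fgcP A) x e0.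
by have [s sP] := galg_gpoly f; exists s; rewrite sP.
Qed.

Lemma rep_op_le (H : hilbertSpace R) (pi : unitary_rep G H) s (x : H) :
  hnorm (rep_op pi s x) <= cnorm (geval u s) * hnorm x.
Proof.
have [f fP] := gpoly_galg s; rewrite /rep_op -!fP.
by have [_] := fgc_norm_ub (fgcP A) f; apply.
Qed.

Lemma cnorm_geval_le s (M : R) : 0 <= M ->
    (forall (H : hilbertSpace R) (pi : unitary_rep G H) (x : H),
      hnorm (rep_op pi s x) <= M * hnorm x) ->
  cnorm (geval u s) <= M.
Proof.
move=> M0 sM; have [f fP] := gpoly_galg s; rewrite -fP.
by apply: (fgc_norm_lub (fgcP A)); split=> // H pi x; rewrite fP; apply: sM.
Qed.

Lemma cnorm_embed_le1 g : cnorm (u g) <= 1.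
Proof.
rewrite -[u g]scale1r -geval1; apply: cnorm_geval_le => // H pi x.
by rewrite /rep_op geval1 scale1r mul1r rep_hnorm.
Qed.

(* The positive cone of [A] is proper because it is so in every unitary       *)
(* representation of [G].                                                     *)
Lemma sum_star_eq0 x y : star x * x + star y * y = 0 -> x = 0.
Proof.
move=> xy0; apply: cnorm_eq0.
set X := cnorm x; set Y := cnorm y.
have X0 : 0 <= X := cnorm_ge0 x; have Y0 : 0 <= Y := cnorm_ge0 y.
have sq_dist (z : A) s (e : R) : 0 < e <= 1 -> cnorm (z - geval u s) < e ->
    cnorm (star (geval u s) * geval u s - star z * z) <= e * (2 * cnorm z + 1).
  move=> /andP[e0 e1] sz.
  have s_le : cnorm (geval u s) <= cnorm z + e.
    have := cdistD (geval u s) z 0; rewrite !subr0 cdistC => h.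
    by apply: le_trans h _; rewrite addrC lerD2l ltW.
  rewrite (_ : _ - _ = star (geval u s) * (geval u s - z) +
                       (star (geval u s) - star z) * z); last first.
    by rewrite mulrBr mulrBl addrA subrK.
  have z0 := cnorm_ge0 z; have s0 := cnorm_ge0 (geval u s).
  have d0 := cnorm_ge0 (z - geval u s).
  apply: le_trans (cnormD _ _) _.
  apply: le_trans (lerD (cnormM _ _) (cnormM _ _)) _.
  by rewrite -starB !cnormS (cdistC _ z); nra.
have key (e : R) : 0 < e <= 1 -> X ^+ 2 <= e * (4 * X + 4 * Y + 6).
  move=> e01; have /andP[e0 e1] := e01.
  have [s sx] := gpoly_dense x e0; have [t ty] := gpoly_dense y e0.
  set S := cnorm (geval u s).
  have S0 : 0 <= S := cnorm_ge0 _.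
  suff S_le : S ^+ 2 <= e * (2 * X + 2 * Y + 2).
    have X_le : X <= S + e.
      have := cdistD x (geval u s) 0; rewrite !subr0 -/X -/S => h.
      by apply: le_trans h _; rewrite addrC lerD2l ltW.
    have X2_le : X ^+ 2 <= (S + e) ^+ 2 by rewrite ler_sqr ?nnegrE //; lra.
    have ee : e * e <= e by rewrite ger_pMl.
    by have := sqr_ge0 (S - e); nra.
  (* [w] approximates [x^* x + y^* y = 0], so its norm is at most [d]. In every representation
     [|s z|^2 + |t z|^2] is the real part of [<z, w z>], hence at most [d |z|^2], and so
     [|s| <= sqrt d]. *)
  pose w := gmul (gstar s) s ++ gmul (gstar t) t.
  pose d := e * (2 * X + 2 * Y + 2).
  have w_le : cnorm (geval u w) <= d.
    rewrite /w geval_cat !geval_mul !geval_star -[X in cnorm X]subr0 -xy0.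
    rewrite opprD addrACA; apply: le_trans (cnormD _ _) _.
    have := lerD (sq_dist _ _ _ e01 sx) (sq_dist _ _ _ e01 ty).
    by rewrite -/X -/Y /d; nra.
  have d0 : 0 <= d by apply: le_trans (cnorm_ge0 _) w_le.
  rewrite -/d -[d]sqr_sqrtr // ler_sqr ?nnegrE ?sqrtr_ge0 //.
  apply: cnorm_geval_le; rewrite ?sqrtr_ge0 // => H pi z.
  rewrite -ler_sqr ?nnegrE ?mulr_ge0 ?sqrtr_ge0 ?hnorm_ge0 //.
  rewrite [leRHS]exprMn [Num.sqrt d ^+ 2]sqr_sqrtr //.
  have wE : complex.Re (inner H z (rep_op pi w z)) =
      hnorm (rep_op pi s z) ^+ 2 + hnorm (rep_op pi t z) ^+ 2.
    rewrite /rep_op geval_cat -!/(rep_op pi _ _) !rep_opM linearDr raddfD /=.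
    by rewrite -!rep_op_star !hnorm_sqrE.
  have z0 := hnorm_ge0 z.
  have w_z : hnorm (rep_op pi w z) <= d * hnorm z.
    exact: le_trans (rep_op_le pi w z) (ler_wpM2r z0 w_le).
  have := Re_inner_le z (rep_op pi w z); rewrite wE => Re_le.
  have := ler_wpM2l z0 w_z; rewrite mulrCA -expr2.
  by have := sqr_ge0 (hnorm (rep_op pi t z)); lra.
apply/eqP; rewrite eq_le X0 andbT leNgt; apply/negP => X_gt0.
set M := 4 * X + 4 * Y + 6 in key; have M0 : 0 < M by rewrite /M; lra.
have X2 : 0 < X ^+ 2 by rewrite exprn_gt0.
(* If [X^2 / (2 M)] is an admissible [e], then [key] gives [X^2 <= X^2 / 2]. Otherwise [X^2 > 2 M],
   against [X^2 <= M] from [e = 1]. *)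
have [e_le1|e_gt1] := leP (X ^+ 2 / (2 * M)) 1.
  have := key (X ^+ 2 / (2 * M)).
  rewrite e_le1 divr_gt0 ?mulr_gt0 // => /(_ isT).
  rewrite (_ : _ * M = X ^+ 2 / 2); last by field; rewrite gt_eqF.
  by lra.
have := key (1 : R); rewrite ltr01 lexx => /(_ isT).
by move: e_gt1; rewrite ltr_pdivlMr ?mulr_gt0 //; lra.
Qed.

End FullCstar.
End GroupPolynomials.

(** * A representation linking [pi] to the trivial one *)

Lemma val_Zp_add (N : nat) (x : 'I_N.+2) (k : nat) :
  x + k%:R = ((x + k) %% N.+2)%N :> nat.
Proof. by rewrite Zp_nat /= modnDmr. Qed.

Lemma val_Zp_natB (N k : nat) (x : 'I_N.+2) :
  k%:R - x = ((k + (N.+2 - x)) %% N.+2)%N :> nat.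
Proof. by rewrite Zp_nat /= modnDmr modnDml. Qed.

Lemma val_Zp_natBr (N k : nat) (x : 'I_N.+2) : (k <= N.+2)%N ->
  x - k%:R = ((x + (N.+2 - k)) %% N.+2)%N :> nat.
Proof.
move=> kN; rewrite -val_Zp_add natrB // (_ : N.+2%:R = 0) ?sub0r //.
by apply: val_inj; rewrite Zp_nat /= modnn.
Qed.

Section LinkedRep.
Variables (R : realType) (n : nat) (H : hilbertSpace R).
Variable pi : unitary_rep (freeZ2 n) H.
Variables (i0 i1 i2 : 'I_n).
Hypotheses (i01 : i0 != i1) (i02 : i0 != i2) (i12 : i1 != i2).
Variables (xi : H) (w' : nat).
Local Notation w := w'.+1.
Local Notation N := (9 * w' + 7).+2.
Local Notation site := ('I_N * bool)%type.
Local Notation K := (hilbert_pow H site).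
Local Notation gen := (@freeZ2_gen n).
Implicit Types (x : 'I_N) (l : bool) (h : H) (F : K) (i : site) (j : 'I_n).

Local Notation t := (gen i1 * gen i0)%g.

Definition twist l (g : freeZ2 n) : {linear H -> H} :=
  if l then pi g else idfun.

(* A site [(x, l)] is a point [x] of Z/N on the layer [l]: the layer [true]   *)
(* is twisted by [pi]. Here [N = 9 w], in the form that makes ['I_N] a ring.  *)
Definition linked x := (w <= x < 2 * w)%N.

Definition link_perm j i : site :=
  if j == i0 then (w'%:R - i.1, i.2)
  else if j == i1 then (w%:R - i.1, i.2)
  else if (j == i2) && linked i.1 then (i.1, ~~ i.2)
  else i.

(** On [[0,w)] the generator [v_2] acts as [pi] on one layer and trivially on the other, so that the
    spread vectors are compatible with it. The factor [pi (t ^+ w)] on the link compensates the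
    twist picked up when a vector is then carried back by [t^-w] on the layer of [pi]. *)
Definition link_op j i : {linear H -> H} :=
  if j == i2 then
    if linked i.1 then if i.2 then pi (t ^+ w)%g else pi ((t ^+ w)^-1)%g
    else if (i.2 && (i.1 < w)%N) then pi (gen i2)
    else if ~~ i.2 && (nat_of_ord i.1 \in [:: 4 * w; 6 * w]%N)
      then (reflection xi : {linear H -> H})
    else idfun
  else twist i.2 (gen j).

Lemma twist_isometry l g h k :
  inner H (twist l g h) (twist l g k) = inner H h k.
Proof. by case: l => //; apply: rep_isometry. Qed.

Lemma twistM l g g' h : twist l (g * g')%g h = twist l g (twist l g' h).
Proof. by case: l => //; apply: repM. Qed.

Lemma twist1 l h : twist l 1%g h = h.
Proof. by case: l => //; apply: rep1. Qed.

Lemma twist_hnorm l g h : hnorm (twist l g h) = hnorm h.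
Proof. by apply: isometry_hnorm => *; apply: twist_isometry. Qed.

Lemma link_permK j : involutive (link_perm j).
Proof.
move=> [x l]; rewrite /link_perm.
case: (j == i0) => /=; first by rewrite opprB addrC subrK.
case: (j == i1) => /=; first by rewrite opprB addrC subrK.
by case jx: ((j == i2) && linked x); rewrite /= jx ?negbK.
Qed.

Lemma link_opK j i h : link_op j i (link_op j (link_perm j i) h) = h.
Proof.
have twK l : twist l (gen j) (twist l (gen j) h) = h.
  by rewrite -twistM freeZ2_genK twist1.
case: i => x l; rewrite /link_op /link_perm.
have [->|j2] := eqVneq j i2; last first.
  by case: (j == i0) => //; case: (j == i1).
rewrite eq_sym (negPf i02) eq_sym (negPf i12) /=.
case xB: (linked x); rewrite /= xB.
  by case: l => /=; rewrite -repM (mulgV, mulVg) rep1.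
case: ifP => _; first by rewrite -repM freeZ2_genK rep1.
by case: ifP => // _; apply: reflectionK.
Qed.

Lemma link_op_isometry j i h k :
  inner H (link_op j i h) (link_op j i k) = inner H h k.
Proof.
rewrite /link_op; do !case: ifP => _ //;
  rewrite ?rep_isometry ?twist_isometry //.
exact: reflection_isometry.
Qed.

Definition link_inv j : {linear K -> K} := monomial (link_perm j) (link_op j).

Lemma link_invE j F i :
  (link_inv j F : {ffun site -> H}) i =
  link_op j i ((F : {ffun site -> H}) (link_perm j i)).
Proof. by rewrite ffunE. Qed.

Lemma link_invK j F : link_inv j (link_inv j F) = F.
Proof. exact: (monomialK (@link_permK j) (link_opK j)). Qed.

Lemma link_inv_isometry j F F' :
  inner K (link_inv j F) (link_inv j F') = inner K F F'.
Proof. exact: (monomial_isometry (@link_permK j) (link_op_isometry j)). Qed.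

Definition link_rep : unitary_rep (freeZ2 n) K :=
  involutions_rep link_invK link_inv_isometry.

Lemma link_rep_gen j F : link_rep (gen j) F = link_inv j F.
Proof. exact: involutions_rep_gen. Qed.

Lemma link_gen0E F x l : (link_rep (gen i0) F : {ffun site -> H}) (x, l) =
  twist l (gen i0) ((F : {ffun site -> H}) (w'%:R - x, l)).
Proof.
by rewrite link_rep_gen link_invE /link_perm eqxx /link_op (negPf i02).
Qed.

Lemma link_gen1E F x l : (link_rep (gen i1) F : {ffun site -> H}) (x, l) =
  twist l (gen i1) ((F : {ffun site -> H}) (w%:R - x, l)).
Proof.
rewrite link_rep_gen link_invE /link_perm eq_sym (negPf i01) eqxx.
by rewrite /link_op (negPf i12).
Qed.

Lemma link_gen2E F x l : (link_rep (gen i2) F : {ffun site -> H}) (x, l) =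
  if linked x then
    twist true (if l then t ^+ w else (t ^+ w)^-1)%g
      ((F : {ffun site -> H}) (x, ~~ l))
  else if (l && (x < w)%N) then pi (gen i2) ((F : {ffun site -> H}) (x, l))
  else if ~~ l && (nat_of_ord x \in [:: 4 * w; 6 * w]%N) then
    reflection xi ((F : {ffun site -> H}) (x, l))
  else (F : {ffun site -> H}) (x, l).
Proof.
rewrite link_rep_gen link_invE /link_perm eq_sym (negPf i02) eq_sym (negPf i12).
rewrite /link_op eqxx /=; case: (linked x) => /=; first by case: l.
by case: ifP => _ //; case: ifP.
Qed.

Lemma link_gen_otherE j F i : j != i0 -> j != i1 -> j != i2 ->
  (link_rep (gen j) F : {ffun site -> H}) i =
  twist i.2 (gen j) ((F : {ffun site -> H}) i).
Proof.
move=> /negPf j0 /negPf j1 /negPf j2.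
by rewrite link_rep_gen link_invE /link_perm /link_op j0 j1 j2.
Qed.

Definition point i h : K := [ffun i' : site => if i' == i then h else 0].

Definition spread l h : K :=
  [ffun i : site => if (i.1 < w)%N && (i.2 == l) then h else 0].

Lemma link_rep_t F i : (link_rep t F : {ffun site -> H}) i =
  twist i.2 t ((F : {ffun site -> H}) (i.1 - 1, i.2)).
Proof.
case: i => x l; rewrite repM link_gen1E link_gen0E twistM /=.
by rewrite (_ : w'%:R - (w%:R - x) = x - 1) // mulrS; ring.
Qed.

Lemma link_rep_tX k F i : (link_rep (t ^+ k)%g F : {ffun site -> H}) i =
  twist i.2 (t ^+ k)%g ((F : {ffun site -> H}) (i.1 - k%:R, i.2)).
Proof.
elim: k i => [|k IHk] i.
  by rewrite expg0 rep1 twist1 subr0; case: i.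
rewrite expgS repM link_rep_t IHk (twistM _ t) /=.
by rewrite (_ : i.1 - 1 - k%:R = i.1 - k.+1%:R) // mulrS; ring.
Qed.

Lemma link_rep_point k x l h :
  link_rep (t ^+ k)%g (point (x, l) h) =
  point (x + k%:R, l) (twist l (t ^+ k)%g h).
Proof.
apply/ffunP => -[y l']; rewrite link_rep_tX !ffunE /= !xpair_eqE subr_eq.
case: (y =P _) => _ /=; last by rewrite linear0.
by case: (l' =P l) => [->|_] //=; rewrite linear0.
Qed.

Lemma spread_sum l h : spread l h = \sum_(x : 'I_N | (x < w)%N) point (x, l) h.
Proof.
apply/ffunP => -[y l']; rewrite pow_sum ffunE /=.
rewrite (eq_bigr (fun x => if x == y then if l' == l then h else 0 else 0)).
  rewrite -big_mkcondr /=; case: ifP => [/andP[yw ->]|yw].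
    rewrite (big_pred1 y) // => x /=.
    by case: (x =P y) => [->|_]; rewrite ?yw ?andbF.
  rewrite big1 // => x /andP[xw /eqP xy]; move: yw; rewrite -xy xw /=.
  by move=> ->.
move=> x _; rewrite ffunE xpair_eqE [y == x]eq_sym.
by case: eqP => //=; case: eqP.
Qed.

Lemma point_hnorm i h : hnorm (point i h) = hnorm h.
Proof.
apply/eqP; rewrite -(@eqrXn2 _ 2) ?hnorm_ge0 // hnorm_powE (bigD1 i) //=.
rewrite ffunE eqxx big1 ?addr0 // => i' /negPf i'i.
by rewrite ffunE i'i hnorm0 expr0n.
Qed.

Lemma spread_hnorm l h : hnorm (spread l h) ^+ 2 = w%:R * hnorm h ^+ 2.
Proof.
rewrite hnorm_powE.
rewrite (eq_bigr (fun i : site => if (i.1 < w)%N then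
           if i.2 == l then hnorm h ^+ 2 else 0 else 0)); last first.
  move=> i _; rewrite ffunE; case: (i.1 < w)%N; case: (i.2 == l) => //=;
    by rewrite hnorm0 expr0n.
rewrite -(pair_bigA _ (fun (x : 'I_N) l' => if (x < w)%N then
           if l' == l then hnorm h ^+ 2 else 0 else 0)) /=.
rewrite (eq_bigr (fun x : 'I_N => if (x < w)%N then hnorm h ^+ 2 else 0)).
  rewrite -big_mkcond -(big_ord_widen _ (fun=> hnorm h ^+ 2)); last first.
    by lia.
  by rewrite sumr_const card_ord mulr_natl.
move=> x _; case: ifP => _; last by rewrite big1.
by rewrite -big_mkcond big_pred1_eq.
Qed.

Lemma spreadB l h k : spread l (h - k) = spread l h - spread l k.
Proof.
by apply/ffunP => i; rewrite powD powN !ffunE; case: ifP; rewrite ?subr0.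
Qed.

Lemma spreadZ l c h : spread l (c *: h) = c *: spread l h.
Proof.
by apply/ffunP => i; rewrite powZ !ffunE; case: ifP; rewrite ?scaler0.
Qed.

Lemma spreadD l h k : spread l (h + k) = spread l h + spread l k.
Proof.
by apply/ffunP => i; rewrite powD !ffunE; case: ifP; rewrite ?addr0.
Qed.

(** * The isolated vector and its orbit *)

Definition base : K := point ((4 * w)%:R, false) xi.

Lemma natr_N : N%:R = 0 :> 'I_N.
Proof. by apply: val_inj; rewrite Zp_nat /= modnn. Qed.

Lemma link_flip x h : (w <= x < 2 * w)%N ->
  link_rep (gen i2) (point (x, false) h) = point (x, true) (pi (t ^+ w)%g h).
Proof.
move=> xB; apply/ffunP => -[y l]; rewrite link_gen2E !ffunE /linked.
case: ifP => yB /=; rewrite !xpair_eqE.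
  case: eqP => [_|_]; last by rewrite linear0.
  by case: l; rewrite /= ?linear0.
case: eqP => [yx|_] /=; last by rewrite !linear0 !if_same.
by move: yB; rewrite yx xB.
Qed.

(** On the untwisted layer, shifting [4 w] by [5 w + x] goes once round Z/N to [x]. To reach the
    other layer, shift to [x + w] inside the link, cross it with [v_2], and go back by [w] steps. *)
Lemma base_orbit x l : (x < w)%N -> exists g, point (x, l) xi = link_rep g base.
Proof.
have reach0 (k y : nat) : (4 * w + k = N + y)%N ->
    link_rep (t ^+ k)%g base = point (y%:R, false) xi.
  by move=> kE; rewrite link_rep_point -natrD kE natrD natr_N add0r.
move=> xw; case: l; last first.
  exists (t ^+ (5 * w + x))%g; rewrite (reach0 _ x); last by lia.
  by rewrite natr_Zp.
exists ((t ^+ w)^-1 * (gen i2 * t ^+ (6 * w + x)))%g.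
rewrite repM repM (reach0 _ (x + w)%N); last by lia.
rewrite link_flip; last by rewrite Zp_nat /= modn_small; lia.
rewrite (_ : (x + w)%:R = x + w%:R); last by rewrite natrD natr_Zp.
rewrite -[pi _ xi]/(twist true (t ^+ w)%g xi) -link_rep_point.
by rewrite -repM mulVg rep1.
Qed.

Lemma base_shift :
  link_rep (t ^+ (2 * w))%g base = point ((6 * w)%:R, false) xi.
Proof. by rewrite link_rep_point -natrD -mulnDl. Qed.

Lemma link_reflect (y : nat) : y \in [:: 4 * w; 6 * w]%N ->
  link_rep (gen i2) (point (y%:R, false) xi) = - point (y%:R, false) xi.
Proof.
move=> yE; apply/ffunP => -[z l]; rewrite powN link_gen2E !ffunE.
have zy : (z == y%:R) = (nat_of_ord z == y).
  rewrite -val_eqE Zp_nat /= modn_small //.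
  by move: yE; rewrite !inE => /orP[] /eqP->; lia.
rewrite /linked.
rewrite !xpair_eqE zy; case: eqP => [zE|_] /=; last first.
  by rewrite !linear0 !if_same.
have -> : (w <= z < 2 * w)%N = false.
  by move: yE; rewrite -zE !inE => /orP[] /eqP->; lia.
rewrite zE yE andbT; case: l => /=; last by rewrite reflection_self.
by rewrite !linear0 if_same.
Qed.

Lemma base_reflect : link_rep (gen i2) base = - base.
Proof. by apply: link_reflect; rewrite inE eqxx. Qed.

(** Conjugating [v_2] by [t^(2 w)] makes it act at the site [4 w] of [base] as [v_2] acts at [6 w],
    the second reflecting site. *)
Definition shifted_gen : freeZ2 n :=
  ((t ^+ (2 * w))^-1 * (gen i2 * t ^+ (2 * w)))%g.

Lemma base_shift_reflect : link_rep shifted_gen base = - base.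
Proof.
rewrite /shifted_gen repM repM base_shift link_reflect ?inE ?eqxx ?orbT //.
by rewrite -base_shift linearN -repM mulVg rep1.
Qed.

(** At these points [v_2] is the identity on both layers. The points [4 w] and [6 w] are excluded
    although only one of their layers carries a reflection, so that the condition depends on the
    point alone. *)
Definition inert x :=
  (2 * w <= x)%N && (nat_of_ord x \notin [:: 4 * w; 6 * w]%N).

Lemma inert_fix F x l : inert x ->
  (F - link_rep (gen i2) F : {ffun site -> H}) (x, l) = 0.
Proof.
case/andP=> x2w /negPf xN; rewrite powD powN link_gen2E /linked.
have -> : (w <= x < 2 * w)%N = false by lia.
have -> : (x < w)%N = false by lia.
by rewrite andbF xN andbF subrr.
Qed.

(* The shift by [2 w] sends every site moved by [link_inv i2] to an inert     *)
(* one, except the site of [base].                                            *)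
Lemma base_isolated F : exists b : R[i],
  let F' := F - link_rep (gen i2) F in F' - link_rep shifted_gen F' = b *: base.
Proof.
pose G := F - link_rep (gen i2) F.
pose Y := link_rep (t ^+ (2 * w))%g G.
suff [b bP] : exists b : R[i],
    Y - link_rep (gen i2) Y = b *: point ((6 * w)%:R, false) xi.
  exists b => F'; rewrite /F' -/G {F'}.
  have GE : G = link_rep ((t ^+ (2 * w))^-1)%g Y by rewrite -repM mulVg rep1.
  transitivity (link_rep ((t ^+ (2 * w))^-1)%g (Y - link_rep (gen i2) Y)).
    rewrite [RHS]linearB -GE; congr (_ - _).
    by rewrite /shifted_gen !repM.
  by rewrite bP -base_shift linearZ -repM mulVg rep1.
have Yval (x : 'I_N) l : inert (x - (2 * w)%:R) ->
    (Y : {ffun site -> H}) (x, l) = 0.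
  by move=> xi'; rewrite link_rep_tX inert_fix ?linear0.
(* The coefficient is read off from [y - reflection xi y] at the only site that survives. *)
exists (2 * inner H ((Y : {ffun site -> H}) ((6 * w)%:R, false)) xi /
        inner H xi xi).
apply/ffunP => -[x l].
have [x_inert|] := boolP (inert x).
  rewrite inert_fix // !ffunE xpair_eqE.
  case: eqP => [xE|_] /=; last by rewrite scaler0.
  move: x_inert; rewrite xE /inert Zp_nat /= modn_small; last by lia.
  by rewrite !inE eqxx orbT andbF.
move=> x_moved.
have [xE|x6w] := eqVneq (nat_of_ord x) (6 * w)%N.
  have -> : x = (6 * w)%:R by rewrite -xE natr_Zp.
  rewrite powD powN powZ link_gen2E ffunE xpair_eqE eqxx /linked.
  rewrite Zp_nat /= modn_small; last by lia.
  have -> : (w <= 6 * w < 2 * w)%N = false by lia.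
  have -> : (6 * w < w)%N = false by lia.
  rewrite !inE eqxx orbT andbF andbT.
  case: l => /=; first by rewrite subrr scaler0.
  by rewrite /reflection opprB addrC subrK.
(* The remaining moved points are [[0, 2 w)] and [4 w]. Subtracting [2 w] sends them to [[7 w, 9 w)]
   and [2 w], all inert. *)
have Y0 l' : (Y : {ffun site -> H}) (x, l') = 0.
  apply: Yval; rewrite /inert val_Zp_natBr; last by lia.
  have := ltn_ord x; move: x_moved x6w; rewrite /inert !inE.
  move: (nat_of_ord x) => y; have [y2w _ _ _|y2w] := ltnP y (2 * w).
    by rewrite modn_small; lia.
  rewrite /= negbK => yE y6 yN.
  have -> : (y + (N - 2 * w) = 2 * w + N)%N by lia.
  by rewrite modnDr modn_small; lia.
rewrite powD powN powZ link_gen2E !Y0 !linear0 !if_same subr0 ffunE xpair_eqE.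
case: eqP => [xE|_] /=; last by rewrite scaler0.
by move: x6w; rewrite xE Zp_nat /= modn_small ?eqxx //; lia.
Qed.

(** * Almost invariance of the spread vectors *)

Lemma spreadE l h x l' : (spread l h : {ffun site -> H}) (x, l') =
  if (x < w)%N then if l' == l then h else 0 else 0.
Proof. by rewrite ffunE /=; case: (x < w)%N. Qed.

Lemma twist_if l l' g h :
  twist l' g (if l' == l then h else 0) = if l' == l then twist l g h else 0.
Proof. by case: eqP => [->|_]; rewrite ?linear0. Qed.

Lemma spread_gen0 l h :
  link_rep (gen i0) (spread l h) = spread l (twist l (gen i0) h).
Proof.
apply/ffunP => -[x l']; rewrite link_gen0E !spreadE val_Zp_natB.
have -> : ((w' + (N - x)) %% N < w)%N = (x < w)%N.
  have := ltn_ord x; move: (nat_of_ord x) => y yN.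
  have [yw|wy] := ltnP y w; last by rewrite modn_small; lia.
  have -> : (w' + (N - y) = w' - y + N)%N by lia.
  by rewrite modnDr modn_small; lia.
by case: ifP => _; rewrite ?twist_if ?linear0.
Qed.

(** The map [x |-> w - x] sends [[0,w)] to [[1,w]]: one end point is gained and one lost, whatever
    [w] is. *)
Lemma spread_gen1 l h (k := twist l (gen i1) h) :
  link_rep (gen i1) (spread l h) =
  spread l k + (point (w%:R, l) k - point (0, l) k).
Proof.
apply/ffunP => -[x l']; rewrite !powD powN link_gen1E !spreadE val_Zp_natB.
rewrite !ffunE !xpair_eqE.
have -> : (x == w%:R) = (nat_of_ord x == w).
  by rewrite -val_eqE Zp_nat /= modn_small //; lia.
have -> : (x == 0) = (nat_of_ord x == 0%N) by [].
have := ltn_ord x; move: (nat_of_ord x) => y yN.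
have -> : ((w + (N - y)) %% N < w)%N = (0 < y <= w)%N.
  have [yw|wy] := leqP y w; last by rewrite modn_small; lia.
  have -> : (w + (N - y) = w - y + N)%N by lia.
  by rewrite modnDr modn_small; lia.
have [->|y0] := eqVneq y 0%N.
  rewrite /= linear0; case: ifP => _; last by rewrite subr0 addr0.
  by rewrite sub0r subrr.
have [->|yw] := eqVneq y w.
  by rewrite leqnn ltnn /= twist_if add0r subr0.
have -> : (0 < y <= w)%N = (y < w)%N by lia.
by rewrite /= subr0 addr0; case: ifP => _; rewrite ?twist_if ?linear0.
Qed.

Lemma spread_gen2 l h :
  link_rep (gen i2) (spread l h) = spread l (twist l (gen i2) h).
Proof.
apply/ffunP => -[x l']; rewrite link_gen2E !spreadE /linked.
have [xw|wx] := ltnP x w; last by rewrite !linear0 !if_same.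
have -> : (nat_of_ord x \in [:: 4 * w; 6 * w]%N) = false by rewrite !inE; lia.
by rewrite /= andbF andbT -twist_if; case: l'.
Qed.

Lemma spread_gen_other j l h : j != i0 -> j != i1 -> j != i2 ->
  link_rep (gen j) (spread l h) = spread l (twist l (gen j) h).
Proof.
move=> j0 j1 j2; apply/ffunP => -[x l'].
rewrite link_gen_otherE // !spreadE /=.
by case: ifP => _; rewrite ?twist_if ?linear0.
Qed.

Lemma spread_gen_le j l h :
  hnorm (link_rep (gen j) (spread l h) - spread l (twist l (gen j) h))
    <= 2 * hnorm h.
Proof.
have h0 := hnorm_ge0 h.
have [->|j0] := eqVneq j i0; first by rewrite spread_gen0 subrr hnorm0; lra.
have [->|j1] := eqVneq j i1.
  rewrite spread_gen1 addrC addKr; set k := twist l (gen i1) h.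
  have := ler_hnormB (point (w%:R, l) k) (point (0, l) k).
  rewrite !point_hnorm twist_hnorm; lra.
have [->|j2] := eqVneq j i2; first by rewrite spread_gen2 subrr hnorm0; lra.
by rewrite spread_gen_other // subrr hnorm0; lra.
Qed.

End LinkedRep.

(* [C] does not depend on [w'], while the norm of the spread vectors grows    *)
(* with [w'].                                                                 *)
Lemma spread_almost_invariant (R : realType) (n : nat) (H : hilbertSpace R)
    (pi : unitary_rep (freeZ2 n) H) (i0 i1 i2 : 'I_n)
    (i01 : i0 != i1) (i02 : i0 != i2) (i12 : i1 != i2) (xi : H) (g : freeZ2 n) :
  exists2 C : R, 0 <= C & forall w' l h,
    hnorm (link_rep pi i02 i12 xi w' g (spread w' l h) -
           spread w' l (twist pi l g h)) <= C * hnorm h.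
Proof.
elim/freeZ2_ind: g => [|j g [C C0 IHg]].
  by exists 0 => // w' l h; rewrite rep1 twist1 subrr hnorm0 mul0r.
exists (C + 2); first lra.
move=> w' l h; rewrite repM twistM mulrDl.
set V := link_rep _ _ _ _ _ in IHg *.
set k := spread w' l (twist pi l g h).
apply: le_trans (hdistD _ (V (freeZ2_gen j) k) _) _.
apply: lerD; first by rewrite -linearB rep_hnorm.
by rewrite -(twist_hnorm pi l g h); apply: spread_gen_le.
Qed.

(** * The centre *)

Section NearCentral.
Variables (R : realType) (G : groupType) (H : hilbertSpace R).
Variables (rho : unitary_rep G H) (T : {linear H -> H}) (d : R).
Hypothesis T_comm :
  forall g x, hnorm (T (rho g x) - rho g (T x)) <= d * hnorm x.
Implicit Types (x e : H) (g h : G).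

Lemma comm_reflect g e : rho g e = - e ->
  hnorm (T e + rho g (T e)) <= d * hnorm e.
Proof.
move=> ge; have := T_comm g e.
by rewrite ge linearN -hnorm_opp opprB opprK addrC.
Qed.

(* [e] lies in the intersection of the ranges of [(1 - g) / 2] and            *)
(* [(1 - h) / 2], and the product of these contractions maps [T e] to [Ce].   *)
Lemma near_eigenvector g h e (b : R[i]) : rho g e = - e -> rho h e = - e ->
    (let y := T e - rho g (T e) in y - rho h y = b *: e) ->
  hnorm (T e - (b / 4) *: e) <= d * hnorm e.
Proof.
move=> ge he /= yE; set z := T e in yE *.
have gz : hnorm (z + rho g z) <= d * hnorm e := comm_reflect ge.
have hz : hnorm (z + rho h z) <= d * hnorm e := comm_reflect he.
(* This is [4 - (1 - h)(1 - g) = 2 (1 + h) + (1 + g) - h (1 + g)] applied to [z]; [1 + g] and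
   [1 + h] are small there. *)
have four : 4 *: (z - (b / 4) *: e) =
    (z + rho h z) + (z + rho h z) + (z + rho g z) - rho h (z + rho g z).
  rewrite scalerBr scalerA mulrCA divff ?mulr1; last by rewrite pnatr_eq0.
  rewrite -yE (linearB (rho h)) (linearD (rho h)).
  rewrite scaler_nat !mulrS mulr0n addr0.
  by rewrite !opprB !opprD !addrA [LHS](ACl (1*2*3*5*6*7*(4*8)))
    [RHS](ACl (1*3*5*2*8*6*(4*7))) /= !subrr.
have : hnorm (4 *: (z - (b / 4) *: e)) <= 4 * (d * hnorm e).
  rewrite four; apply: le_trans (ler_hnormB _ _) _; rewrite rep_hnorm.
  apply: le_trans (lerD (ler_hnormD _ _) (lexx _)) _.
  apply: le_trans (lerD (lerD (ler_hnormD _ _) (lexx _)) (lexx _)) _.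
  lra.
rewrite hnormZ (_ : Normc.normc 4 = 4); first lra.
by rewrite -(rmorph_nat (real_complex R)) normc_real normr_nat.
Qed.

Lemma near_eigenvector_orbit (b : R[i]) e g :
    hnorm (T e - b *: e) <= d * hnorm e ->
  hnorm (T (rho g e) - b *: rho g e) <= 2 * d * hnorm e.
Proof.
move=> Te; have := hdistD (T (rho g e)) (rho g (T e)) (b *: rho g e).
rewrite -linearZ -linearB rep_hnorm; have := T_comm g e.
lra.
Qed.

End NearCentral.

Section Centre.
Variables (R : realType) (n : nat) (A : fullGroupCstar R (freeZ2 n)).
Local Notation u := (fgc_embed A).
Local Notation gpoly := (seq (R[i] * freeZ2 n)).
Variables (i0 i1 i2 : 'I_n).
Hypotheses (i01 : i0 != i1) (i02 : i0 != i2) (i12 : i1 != i2).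
Implicit Types (s f : gpoly) (g : freeZ2 n) (e d : R).

(** The value of [s] in the trivial representation. *)
Definition augmentation s : R[i] := \sum_(p <- s) p.1.

Lemma spread_geval (H : hilbertSpace R) (pi : unitary_rep (freeZ2 n) H)
    (xi : H) s :
  exists2 C : R, 0 <= C & forall w' l h,
    hnorm (rep_op (link_rep pi i02 i12 xi w') s (spread w' l h) -
           spread w' l (geval (fun g => twist pi l g h) s)) <= C * hnorm h.
Proof.
elim: s => [|[c g] s [C C0 IHs]].
  exists 0 => // w' l h; rewrite /rep_op /geval !big_nil.
  rewrite (_ : spread w' l 0 = 0) ?subrr ?hnorm0 ?mul0r //.
  by apply/ffunP => i; rewrite !ffunE if_same.
have [Cg Cg0 gP] := spread_almost_invariant pi i01 i02 i12 xi g.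
exists (Normc.normc c * Cg + C); first by rewrite addr_ge0 ?mulr_ge0 ?normc_ge0.
move=> w' l h; set rho := link_rep _ _ _ _ _ in IHs gP *.
rewrite /rep_op /geval !big_cons -!/(geval _ _) -/(rep_op rho s _) /=.
rewrite spreadD spreadZ opprD addrACA -scalerBr mulrDl -mulrA.
apply: le_trans (ler_hnormD _ _) _; rewrite hnormZ.
apply: lerD; last exact: IHs.
by rewrite ler_wpM2l ?normc_ge0 ?gP.
Qed.

Lemma geval_twist0 (H : hilbertSpace R) (pi : unitary_rep (freeZ2 n) H)
    (h : H) s :
  geval (fun g => twist pi false g h) s = augmentation s *: h.
Proof. by rewrite /geval /augmentation scaler_suml. Qed.

Variable a : A.
Hypothesis a_central : forall g, a * u g = u g * a.

(** As [a] is central, the commutator of [s] with [g] equals that of [s - a], which has norm at most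
    [2 d]. *)
Lemma near_comm s d (H : hilbertSpace R) (rho : unitary_rep (freeZ2 n) H) g
    (x : H) :
    cnorm (a - geval u s) <= d ->
  hnorm (rep_op rho s (rho g x) - rho g (rep_op rho s x)) <= 2 * d * hnorm x.
Proof.
move=> sa; pose v := gmul s [:: (1, g)] ++ gscale (-1) (gmul [:: (1, g)] s).
have -> : rep_op rho s (rho g x) - rho g (rep_op rho s x) = rep_op rho v x.
  rewrite /rep_op geval_cat geval_scale -!/(rep_op rho _ _) !rep_opM scaleN1r.
  by rewrite /rep_op !geval1 !scale1r.
apply: le_trans (rep_op_le A rho v x) _; rewrite ler_wpM2r ?hnorm_ge0 //.
have -> : geval u v = (geval u s - a) * u g - u g * (geval u s - a).
  rewrite geval_cat geval_scale !geval_mul !geval1 !scale1r scaleN1r.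
  by rewrite mulrBl mulrBr a_central opprB addrA subrK.
have u1 := cnorm_embed_le1 A g; have u0 := cnorm_ge0 (u g).
have d0 := cnorm_ge0 (a - geval u s).
apply: le_trans (cnormB _ _) _.
apply: le_trans (lerD (cnormM _ _) (cnormM _ _)) _.
rewrite cdistC in sa d0 *; nra.
Qed.

(** One [b] serves both layers because all [w] points of either spread vector lie in the orbit of
    [base]; their errors are added up, hence the factor [w]. *)
Lemma spread_near_eigenvector (H : hilbertSpace R)
    (pi : unitary_rep (freeZ2 n) H) (xi : H) (w' : nat) f d :
    cnorm (a - geval u f) <= d ->
  exists b : R[i], forall l,
    hnorm (rep_op (link_rep pi i02 i12 xi w') f (spread w' l xi) -
           b *: spread w' l xi) <= w'.+1%:R * (4 * d * hnorm xi).
Proof.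
move=> fa; set rho := link_rep _ _ _ _ _.
pose T : {linear _ -> _} := rep_op rho f.
have Tcomm g x : hnorm (T (rho g x) - rho g (T x)) <= 2 * d * hnorm x.
  exact: near_comm.
have [b bP] := base_isolated pi i01 i02 i12 xi (T (base xi w')).
exists (b / 4) => l.
have e_eigen : hnorm (T (base xi w') - (b / 4) *: base xi w') <=
    2 * d * hnorm (base xi w').
  by apply: (near_eigenvector Tcomm _ _ bP);
    [apply: base_reflect | apply: base_shift_reflect].
rewrite spread_sum linear_sum scaler_sumr -sumrB.
apply: le_trans (hnorm_sum _ _ _) _.
apply: (@le_trans _ _
    (\sum_(x < (9 * w' + 7).+2 | (x < w'.+1)%N) 4 * d * hnorm xi)).
  apply: ler_sum => x xw; have [g ->] := base_orbit pi i01 i02 i12 xi l xw.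
  apply: le_trans (near_eigenvector_orbit Tcomm g e_eigen) _.
  by rewrite point_hnorm; lra.
rewrite -(big_ord_widen _ (fun=> 4 * d * hnorm xi)); last by lia.
by rewrite sumr_const card_ord -[leLHS]mulr_natl.
Qed.

(** The order of choices matters: the constant [C] of almost invariance depends on [s], then [w] is
    taken large for [C], and then a second approximant [f] of [a] is taken fine enough for [w],
    since the eigenvector error grows with [w]. *)
Lemma rep_near_augmentation (H : hilbertSpace R) (pi : unitary_rep (freeZ2 n) H)
    (xi : H) s e : 0 < e -> cnorm (a - geval u s) <= e ->
  hnorm (rep_op pi s xi - augmentation s *: xi) <= 6 * e * hnorm xi.
Proof.
move=> e0 sa; have [C C0 CP] := spread_geval pi xi s.
(* With [w = m^2] the spread vectors have norm [m |xi|], so the bounded errors [C |xi|] and [4 |xi|]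
   together cost at most [e] relative to it. *)
pose m := (Num.truncn ((C + 4) / e)).+1.
have m_gt : C + 4 <= m%:R * e.
  by rewrite -ler_pdivrMr // ltW // truncnS_gt // divr_ge0 // ?ltW // ler_wpDl.
pose w' := (m ^ 2).-1.
have wE : w'.+1 = (m ^ 2)%N by rewrite prednK // expn_gt0.
have m0 : 0 < m%:R :> R by rewrite ltr0n.
(* The bound [e] keeps [f] within [2 e] of [s]; the bound [1 / m^2] cancels the factor [w] of the
   eigenvector error. *)
pose d : R := Num.min e (m ^ 2)%:R^-1.
have d0 : 0 < d by rewrite lt_min e0 invr_gt0 ltr0n expn_gt0.
have [f fa] := gpoly_dense a d0.
have [b bP] := spread_near_eigenvector pi xi w' (ltW fa).
pose rho := link_rep pi i02 i12 xi w'.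
have spreadM (l : bool) (h : H) : hnorm (spread w' l h) = m%:R * hnorm h.
  apply/eqP; rewrite -(@eqrXn2 _ 2) ?hnorm_ge0 ?mulr_ge0 ?hnorm_ge0 ?ltW //.
  by rewrite (spread_hnorm i01 i02 i12) wE exprMn natrX.
have near_b l : hnorm (geval (fun g => twist pi l g xi) s - b *: xi) <=
    3 * e * hnorm xi.
  set E := geval _ _.
  rewrite -(ler_pM2l m0) -(spreadM l) spreadB spreadZ.
  have h0 := hnorm_ge0 xi.
  have d1 := CP w' l xi.
  have d2 :
      hnorm (rep_op rho s (spread w' l xi) - rep_op rho f (spread w' l xi))
      <= 2 * e * (m%:R * hnorm xi).
    rewrite -(spreadM l); pose v := s ++ gscale (-1) f.
    have -> : rep_op rho s (spread w' l xi) - rep_op rho f (spread w' l xi) =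
        rep_op rho v (spread w' l xi).
      by rewrite /rep_op geval_cat geval_scale scaleN1r.
    apply: le_trans (rep_op_le A rho v _) _; rewrite ler_wpM2r ?hnorm_ge0 //.
    rewrite geval_cat geval_scale scaleN1r.
    have := cdistD (geval u s) a (geval u f); rewrite (cdistC (geval u s) a).
    have : d <= e by rewrite ge_min lexx.
    move: fa => /ltW; lra.
  have d3 := bP l; rewrite wE in d3.
  have d4 : (m ^ 2)%:R * (4 * d * hnorm xi) <= 4 * hnorm xi.
    have : (m ^ 2)%:R * d <= 1.
      by rewrite mulrC -ler_pdivlMr ?ltr0n ?expn_gt0 // div1r ge_min lexx orbT.
    by rewrite -(ler_pM2r (_ : 0 < 4)) // => /(ler_wpM2r h0); lra.
  have t1 := hdistD (spread w' l E) (rep_op rho s (spread w' l xi))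
    (b *: spread w' l xi).
  have t2 := hdistD (rep_op rho s (spread w' l xi))
    (rep_op rho f (spread w' l xi)) (b *: spread w' l xi).
  have t3 : (C + 4) * hnorm xi <= m%:R * e * hnorm xi by rewrite ler_wpM2r.
  rewrite hdistC in d1; lra.
have := hdistD (rep_op pi s xi) (b *: xi) (augmentation s *: xi).
have : hnorm (rep_op pi s xi - b *: xi) <= 3 * e * hnorm xi := near_b true.
by have := near_b false; rewrite geval_twist0 (hdistC (_ *: xi) (b *: xi)); lra.
Qed.

Lemma central_near_scalar e : 0 < e -> exists c : R[i], cnorm (a - c *: 1) <= e.
Proof.
(* One seventh for approximating [a] by [s], six for approximating [s] by its augmentation. *)
move=> e0; have e'0 : 0 < e / 7 by rewrite divr_gt0.
have [s sa] := gpoly_dense a e'0; exists (augmentation s).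
have := cdistD a (geval u s) (augmentation s *: 1).
suff : cnorm (geval u s - augmentation s *: 1) <= 6 * (e / 7) by lra.
have -> : geval u s - augmentation s *: 1 =
    geval u (s ++ [:: (- augmentation s, 1%g)]).
  by rewrite geval_cat geval1 fgc_embed1 scaleNr.
apply: cnorm_geval_le => [|H pi x]; first by rewrite mulr_ge0 ?ltW.
rewrite /rep_op geval_cat geval1 rep1 scaleNr.
exact: rep_near_augmentation (ltW sa).
Qed.

End Centre.

(** * The scalars are closed in a C*-algebra *)

Section ScalarLimits.
Variable R : realType.

Lemma real_cauchy_complete : cauchy_complete (fun r : R => `|r|).
Proof.
move=> x xC.
(* The limit is the supremum of the eventual lower bounds. *)
pose S := [set y : R | exists N, forall k, (N <= k)%N -> y <= x k]%classic.
have bounds e N : 0 < e ->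
    (forall j k, (N <= j)%N -> (N <= k)%N -> `|x j - x k| < e) ->
  S (x N - e) /\ ubound S (x N + e).
  move=> e0 xN; split.
    by exists N => k Nk; have := xN N k (leqnn _) Nk; rewrite ltr_norml; lra.
  move=> y [M yM]; have := yM (maxn M N) (leq_maxl _ _).
  by have := xN N (maxn M N) (leqnn _) (leq_maxr _ _); rewrite ltr_norml; lra.
have S_sup : has_sup S.
  have [N xN] := xC 1 ltr01; have [S1 S2] := bounds _ _ ltr01 xN.
  by split; [exists (x N - 1) | exists (x N + 1)].
exists (sup S) => e e0; have e2 : 0 < e / 2 by rewrite divr_gt0.
have [N xN] := xC _ e2; have [S1 S2] := bounds _ _ e2 xN.
exists N => k Nk; have := xN k N Nk (leqnn _).
have := sup_upper_bound S_sup S1.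
have := ge_sup S_sup.1 S2.
by rewrite !ltr_norml; lra.
Qed.

Lemma near_scalars (A : cstarAlgType R) (a : A) :
    (forall e : R, 0 < e -> exists c : R[i], cnorm (a - c *: 1) <= e) ->
  exists c : R[i], a = c *: 1.
Proof.
move=> near; have [one0|k_neq0] := eqVneq (cnorm (1 : A)) 0.
  by exists 0; rewrite -[a]mulr1 (cnorm_eq0 _ one0) mulr0 scaler0.
set k := cnorm 1 in k_neq0; have k0 : 0 < k by rewrite lt_def k_neq0 cnorm_ge0.
have eps_gt0 (N : nat) : 0 < (N.+1%:R)^-1 :> R by rewrite invr_gt0.
have /choice[c cP] := fun N : nat => near _ (eps_gt0 N).
have eps_lt (e : R) : 0 < e ->
    exists N : nat, forall j, (N <= j)%N -> (j.+1%:R)^-1 < e.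
  move=> e0; exists (Num.truncn e^-1) => j Nj; rewrite invf_plt ?posrE //.
  by apply: lt_le_trans (truncnS_gt _) _; rewrite ler_nat ltnS.
have c_cauchy (e : R) : 0 < e ->
    exists N, forall i j, (N <= i)%N -> (N <= j)%N ->
      Normc.normc (c i - c j) < e.
  move=> e0; have [|N NP] := eps_lt (e * k / 2).
    by rewrite divr_gt0 ?mulr_gt0.
  exists N => i j Ni Nj; rewrite -(ltr_pM2r k0) -cnormZE scalerBl.
  have := cdistD (c i *: 1) a (c j *: 1); rewrite (cdistC _ a).
  have := cP i; have := cP j; have := NP _ Ni; have := NP _ Nj.
  by move: (i.+1%:R^-1) (j.+1%:R^-1) => p q; lra.
have [r rP] : exists l : R, forall e : R, 0 < e ->
    exists N, forall j, (N <= j)%N -> `|complex.Re (c j) - l| < e.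
  apply: real_cauchy_complete => e /c_cauchy[N NP]; exists N => i j Ni Nj.
  by apply: le_lt_trans (NP i j Ni Nj); rewrite -raddfB normc_ge_Re.
have [t tP] : exists l : R, forall e : R, 0 < e ->
    exists N, forall j, (N <= j)%N -> `|complex.Im (c j) - l| < e.
  apply: real_cauchy_complete => e /c_cauchy[N NP]; exists N => i j Ni Nj.
  by apply: le_lt_trans (NP i j Ni Nj); rewrite -raddfB normc_ge_Im.
exists (r +i* t)%C; apply/eqP; rewrite -subr_eq0; apply/eqP/cnorm_eq0.
apply/eqP; rewrite eq_le cnorm_ge0 andbT; apply/ler_addgt0Pl => e e0.
have e3 : 0 < e / 3 by rewrite divr_gt0.
have e3k : 0 < e / 3 / k by rewrite divr_gt0.
have [N1 NP1] := eps_lt _ e3.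
have [N2 NP2] := rP _ e3k; have [N3 NP3] := tP _ e3k.
pose N := maxn N1 (maxn N2 N3).
have := cdistD a (c N *: 1) ((r +i* t)%C *: 1).
rewrite -scalerBl cnormZE -/k.
have cN : cnorm (a - c N *: 1) <= e / 3.
  by apply: le_trans (cP N) _; apply/ltW/NP1/leq_maxl.
have zN : Normc.normc (c N - (r +i* t)%C) * k <= e / 3 + e / 3.
  rewrite -ler_pdivlMr // mulrDl; apply: le_trans (normc_le _) _.
  apply: lerD; rewrite raddfB /= ltW //; [apply: NP2 | apply: NP3].
    by rewrite leq_max leq_max leqnn !orbT.
  by rewrite leq_max leq_max leqnn !orbT.
lra.
Qed.
End ScalarLimits.

(** * Purity *)

Section PositiveSplitting.
Variables (R : realType) (G : groupType) (A : fullGroupCstar R G).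
Implicit Types x y z w r : A.

Lemma star_star x : star (star x * x) = star x * x.
Proof. by rewrite starM starK. Qed.

(** Multiplying [x] by [star r] and [r] gives the sum of the squares of [y r] and [z r], so both
    vanish with [x r]. *)
Lemma summand_kernel x y z r : star y * y + star z * z = x -> x * r = 0 ->
  star y * y * r = 0.
Proof.
move=> xE xr; suff yr : y * r = 0 by rewrite -mulrA yr mulr0.
apply: (@sum_star_eq0 _ _ A _ (z * r)).
have -> : star (y * r) * (y * r) + star (z * r) * (z * r) = star r * (x * r).
  by rewrite -xE mulrDl mulrDr !starM !mulrA.
by rewrite xr mulr0.
Qed.

(** For negative [r], adding the square of the scalar [sqrt (- r)] gives zero, which the proper cone
    forbids. *)
Lemma scalar_star_ge0 (r : R) y : (1 : A) != 0 ->
  star y * y = r%:C%C *: 1 -> 0 <= r.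
Proof.
move=> one_neq0 yE; rewrite leNgt; apply/negP => r_lt0.
pose z : A := (Num.sqrt (- r))%:C%C *: 1.
have zE : star z * z = (- r)%:C%C *: 1.
  rewrite /z starZ star1 conj_real -scalerAl mul1r scalerA -rmorphM /=.
  by rewrite -expr2 sqr_sqrtr // oppr_ge0 ltW.
have /eqP : z = 0.
  apply: (@sum_star_eq0 _ _ A _ y).
  by rewrite zE yE -scalerDl -rmorphD /= addNr scale0r.
rewrite scaler_eq0 (negPf one_neq0) orbF.
move=> /eqP/(congr1 (@complex.Re R))/eqP /=.
by rewrite sqrtr_eq0 oppr_le0 leNgt r_lt0.
Qed.

End PositiveSplitting.

Section CompletelyPositive.
Variables (R : realType) (A B : cstarAlgType R).
Variables (S : opSystem A) (T : opSystem B).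

(** Complete positivity read on 1-by-1 matrices. *)
Lemma cp_star (phi : {linear os_type S -> os_type T}) (x : os_type S) (y : A) :
  is_cp phi -> val x = star y * y -> exists z, val (phi x) = star z * z.
Proof.
move=> /(_ 1%N (const_mx x)) phi_cp xE.
have [|Z ZE] := phi_cp.
  exists (const_mx y); apply/matrixP => i j.
  by rewrite !mxE big_ord1 !mxE.
exists (Z 0 0); have /matrixP/(_ 0 0) := ZE.
by rewrite !mxE big_ord1 !mxE.
Qed.

End CompletelyPositive.

Section OperatorSystemVal.
Variables (R : realType) (A : cstarAlgType R) (S : opSystem A).
Implicit Types (x y : os_type S).

Lemma os_valD x y : val (x + y) = val x + val y.
Proof. exact: (linearD (val : os_type S -> A)). Qed.

Lemma os_valZ (c : R[i]) x : val (c *: x) = c *: val x.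
Proof. exact: (linearZ_LR (val : os_type S -> A)). Qed.

Lemma os_val_sum (I : Type) (r : seq I) (F : I -> os_type S) :
  val (\sum_(i <- r) F i) = \sum_(i <- r) val (F i).
Proof. exact: (linear_sum (val : os_type S -> A)). Qed.

End OperatorSystemVal.

Section Purity.
Variables (R : realType) (n : nat) (A : fullGroupCstar R (freeZ2 n)).
Local Notation u := (fgc_embed A).
Local Notation S := (NC A).
Local Notation gen := (nc_gen A).

Lemma gen_mul j : gen j * gen j = 1.
Proof. by rewrite -fgc_embedM freeZ2_genK fgc_embed1. Qed.

Lemma star_gen j : star (gen j) = gen j.
Proof. by rewrite (fgc_star (fgcP A)) freeZ2_genV. Qed.

Lemma commutes_embed (a : A) :
  (forall j, a * gen j = gen j * a) -> forall g, a * u g = u g * a.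
Proof.
move=> ag; apply: freeZ2_ind => [|j g IHg].
  by rewrite fgc_embed1 mulr1 mul1r.
by rewrite fgc_embedM mulrA (ag j) -[LHS]mulrA IHg mulrA.
Qed.

Lemma nc_set_gen j : nc_set (gen j).
Proof.
exists 0, (fun k => (k == j)%:R).
rewrite scale0r add0r (bigD1 j) //= eqxx scale1r.
by rewrite big1 ?addr0 // => k /negPf->; rewrite scale0r.
Qed.

Definition os_one : os_type S := OsType (introT (os_predP S _) (os_1 S)).
Definition os_gen j : os_type S :=
  OsType (introT (os_predP S _) (nc_set_gen j)).

Section Summand.
Variables theta omega : {linear os_type S -> os_type (os_full A)}.
Hypotheses (theta_cp : is_cp theta) (omega_cp : is_cp omega).
Hypothesis theta_omega : forall x, theta x + omega x = iota_e A x.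

Let valE x : val (theta x) + val (omega x) = val x.
Proof. by rewrite -[RHS]/(val (iota_e A x)) -theta_omega. Qed.

Lemma summand_star x (y : A) : val x = star y * y ->
  star (val (theta x)) = val (theta x) /\
  forall r, val x * r = 0 -> val (theta x) * r = 0.
Proof.
move=> xE; have [t tE] := cp_star theta_cp xE.
have [o oE] := cp_star omega_cp xE.
rewrite tE; split=> [|r xr]; first exact: star_star.
by apply: (@summand_kernel _ _ _ _ t o _ _ xr); rewrite -tE -oE; apply: valE.
Qed.

Lemma summand_sign j (c : R[i]) : c = 1 \/ c = -1 ->
  let p := val (theta os_one) + c *: val (theta (os_gen j)) in
  star p = p /\ p * (1 - c *: gen j) = 0.
Proof.
(* The factor 2 makes [x] a square: [(1 + c v)^2 = 2 (1 + c v)]. *)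
move=> c1 p; pose x := 2 *: (os_one + c *: os_gen j).
have cc : c * c = 1 by case: c1 => ->; rewrite ?mulrNN mulr1.
have c_conj : Num.conj c = c by case: c1 => ->; rewrite ?rmorphN rmorph1.
have xE : val x = 2 *: (1 + c *: gen j).
  by rewrite /x os_valZ os_valD os_valZ.
have px : val (theta x) = 2 *: p.
  rewrite /x (linearZ_LR theta) os_valZ (linearD theta) os_valD.
  by rewrite (linearZ_LR theta) os_valZ.
have two_neq0 : (2 : R[i]) != 0 by rewrite pnatr_eq0.
have sq : val x = star (1 + c *: gen j) * (1 + c *: gen j).
  rewrite xE starD starZ star1 star_gen c_conj.
  rewrite mulrDl mul1r mulrDr mulr1 -scalerAl -scalerAr gen_mul.
  rewrite scalerA cc scale1r.
  by rewrite scaler_nat mulr2n [c *: _ + 1]addrC.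
have [p_star p_ker] := summand_star sq; rewrite px in p_star p_ker.
split.
  move: p_star; rewrite starZ rmorph_nat => /(congr1 (fun y => 2^-1 *: y)).
  by rewrite !scalerA mulVf // !scale1r.
have /p_ker : val x * (1 - c *: gen j) = 0.
  rewrite xE -scalerAl mulrDl mul1r mulrBr mulr1 -scalerAl -scalerAr gen_mul.
  by rewrite scalerA cc scale1r subrKA subrr scaler0.
rewrite -scalerAl => /(congr1 (fun y => 2^-1 *: y)).
by rewrite scalerA mulVf // scale1r scaler0.
Qed.

(** Subtracting [(a - b)(1 + v) = 0] from [(a + b)(1 - v) = 0] leaves [2 b = 2 a v]. As [a], [b] and
    [v] are selfadjoint, the adjoint of [b = a v] is [b = v a]. *)
Lemma summand_gen j (a := val (theta os_one)) :
  val (theta (os_gen j)) = a * gen j /\ a * gen j = gen j * a.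
Proof.
set b := val (theta (os_gen j)).
have [] := summand_sign j (or_introl erefl); rewrite !scale1r -/a -/b => sp pk.
have [] := summand_sign j (or_intror erefl); rewrite !scaleN1r -/a -/b => sm mk.
have b_ag : b = a * gen j.
  have two_b : 2 *: (b - a * gen j) = 0.
    rewrite scaler_nat mulr2n -[RHS](subr0 0) -{1}pk -mk opprK.
    rewrite !mulrBr !mulrDr !mulr1 !mulrDl mulNr !opprD !opprK !addrA.
    by rewrite [RHS](ACl ((2*3*6*7)*(1*5)*(4*8))) /= subrr addNr !addr0.
  move: two_b => /(congr1 (fun y => 2^-1 *: y)).
  rewrite scalerA mulVf ?pnatr_eq0 // scale1r scaler0 => /eqP.
  by rewrite subr_eq0 => /eqP.
have a_star : star a = a.
  by have [] := @summand_star os_one 1; rewrite ?star1 ?mulr1.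
have b_star : star b = b by move: sp; rewrite starD a_star => /addrI.
by split=> //; rewrite -b_ag -[in LHS]b_star b_ag starM star_gen a_star.
Qed.

End Summand.

Lemma os_decompose (x : os_type S) : exists (c : R[i]) (b : 'I_n -> R[i]),
  x = c *: os_one + \sum_(j < n) b j *: os_gen j.
Proof.
have /os_predP[c [b xE]] := valP x; exists c, b; apply: val_inj.
rewrite os_valD os_valZ /= xE os_val_sum.
by congr (_ + _); apply: eq_bigr => j _; rewrite os_valZ.
Qed.

End Purity.

Lemma central_scalar (R : realType) (n : nat) (A : fullGroupCstar R (freeZ2 n))
    (a : A) : (2 < n)%N -> (forall g, a * fgc_embed A g = fgc_embed A g * a) ->
  exists c : R[i], a = c *: 1.
Proof.
move=> n_gt2 a_central; apply: near_scalars => e.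
pose i0 := Ordinal (ltnW (ltnW n_gt2)); pose i1 := Ordinal (ltnW n_gt2).
pose i2 := Ordinal n_gt2.
exact: (@central_near_scalar _ _ _ i0 i1 i2).
Qed.

Local Close Scope ring_scope.

Theorem corollary4p5 (R : realType) (n : nat)
    (A : fullGroupCstar R (freeZ2 n)) (hn : 3 <= n) :
  cp_pure (iota_e A).
Proof.
split=> [p X [Y YE]|theta omega theta_cp omega_cp theta_omega].
  by exists Y; rewrite -YE; apply/matrixP => i j; rewrite !mxE.
have gen_theta j := summand_gen theta_cp omega_cp theta_omega j.
have omegaE x : omega x = (iota_e A x - theta x)%R.
  by rewrite -theta_omega addrC addKr.
have a_central := commutes_embed (fun j => (gen_theta j).2).
have [c aE] := central_scalar hn a_central.
have val_theta x : val (theta x) = (c *: val x)%R.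
  have [d [b ->]] := os_decompose x.
  rewrite (linearD theta) (linearZ_LR theta) (linear_sum theta) !os_valD.
  rewrite !os_valZ !os_val_sum /=.
  rewrite scalerDr scalerA mulrC -scalerA -aE scaler_sumr; congr (_ + _)%R.
  apply: eq_bigr => j _; rewrite (linearZ_LR theta) !os_valZ (gen_theta j).1.
  by rewrite aE -scalerAl mul1r !scalerA mulrC.
have thetaE x : theta x = (c *: iota_e A x)%R.
  by apply: val_inj; apply: etrans (val_theta x) _; rewrite os_valZ.
(* In the zero algebra any [s] will do; otherwise [1 != 0] lets the properties of [c] be read off
   from [c *: 1]. *)
have [one0|one_neq0] := eqVneq (1%R : A) 0%R.
  have all0 (y : os_type (os_full A)) : y = 0%R.
    by apply: val_inj; rewrite -[LHS]mulr1 one0 mulr0.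
  exists 0%R; split=> [|x|x]; first by rewrite lexx ler01.
    by rewrite [LHS]all0 [RHS]all0.
  by rewrite [LHS]all0 [RHS]all0.
have one_star : val (os_one A) = (star 1 * 1 : A)%R by rewrite star1 mulr1.
have [y yE] := cp_star theta_cp one_star.
have [z zE] := cp_star omega_cp one_star.
(* [c] is real because [theta(1)] is selfadjoint. *)
have cE : c = (complex.Re c)%:C%C.
  have /eqP : star (c *: 1 : A)%R = (c *: 1)%R by rewrite -aE yE star_star.
  rewrite starZ star1 -subr_eq0 -scalerBl scaler_eq0 (negPf one_neq0) orbF.
  by rewrite subr_eq0 => /eqP/CrealP/RRe_real.
have cBE : ((1 - complex.Re c)%:C%C = 1 - c)%R by rewrite [in RHS]cE rmorphB.
exists (complex.Re c); split=> [|x|x].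
- apply/andP; split.
    by apply: (scalar_star_ge0 (y := y) one_neq0); rewrite -cE -aE.
  rewrite -subr_ge0; apply: (scalar_star_ge0 (y := z) one_neq0).
  have -> : (star z * z)%R = (1 - val (theta (os_one A)))%R.
    by apply/eqP; rewrite -zE eq_sym subr_eq addrC -os_valD theta_omega.
  by rewrite aE cBE scalerBl scale1r.
- by rewrite thetaE -cE.
- by rewrite omegaE thetaE cBE scalerBl scale1r.
Qed.
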